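(* Let $(X,\rho)$ be a proper geodesic metric space homeomorphic to $\mathbb{R}^2$ whose boundary at infinity $\partial X$ is homeomorphic to $\mathbb{S}^1$ and compactifies $X$ so that $X\cup\partial X$ is homeomorphic to the closed unit disk, and which satisfies (G1), (G2) and (G3). Let $P$ be a convex polygon in $X$, and let $d$ be the function on $P\times P$ constructed as in the context (from a homeomorphism $h$, a set $\Theta$ and weights $(w_i)$). Then $d$ is a metric and $(P,d)$ is a geodesically complete metric space whose geodesic lines are precisely the curves $\{c\cap P\mid c \text{ a geodesic line in } X,\ c\cap P\neq\emptyset\}$.
   Context: $\partial X$ is the set of asymptoty classes of geodesic rays in $X$, with the topology of uniform convergence on compact sets. Properties: (G1) any two points $x,y\in X$ are joined by a unique geodesic segment $[x,y]$, and every segment $[x,y]$ (with $x\ne y$) extends uniquely to a geodesic line (isometric map $\mathbb{R}\to X$). (G2) for any two distinct $\xi,\eta\in\partial X$ there is a unique geodesic line $(\xi,\eta)$ in $X$ joining them. (G3) for any $x\in X$, $\xi\in\partial X$ there is a unique geodesic ray in $X$ from $x$ to $\xi$. $P\subset X$ is convex if $[x,y]\subset P$ for all $x,y\in P$. A convex polygon in $X$ is a nonempty open bounded convex subset of $X$ whose boundary is a finite union of geodesic segments (its sides). Construction of $d$: fix a homeomorphism $h$ from $X\cup\partial X$ to the closed unit disk (mapping $\partial X$ to the unit circle), and use it to speak of clockwise order and of (Euclidean) lengths of arcs in $\partial X$. For $x\in X$, $\theta\in\partial X$, let $x_\theta\in\partial X$ be the other endpoint of the geodesic line through $x$ having $\theta$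 as one endpoint. For each $\theta\in\partial X$ there are unique points $\xi_\theta,\eta_\theta\in\partial X$ such that the region bounded by the lines $(\theta,\xi_\theta)$, $(\theta,\eta_\theta)$ and the arc of $\partial X$ from $\xi_\theta$ to $\eta_\theta$ not containing $\theta$ contains $P$ and is minimal with this property, labelled so that $\theta,\eta_\theta,\xi_\theta$ are in clockwise order. For $a,b$ in the arc between $\eta_\theta$ and $\xi_\theta$ not containing $\theta$, $|ab|$ is the length of the subarc between $a,b$ not containing $\theta$. For $x,y\in P$, named so that the clockwise order is $\eta_\theta,y_\theta,x_\theta,\xi_\theta$ (with $x_\theta=y_\theta$ allowed), $$d_\theta(x,y):=\log\frac{|\eta_\theta x_\theta|\,|\xi_\theta y_\theta|}{|\eta_\theta y_\theta|\,|\xi_\theta x_\theta|}.$$ $\Theta=\{\theta_i\mid i\in\mathbb{N}\}$ is a countable dense subset of $\partial X$ containing both endpoints of the geodesic line containing each side of $P$; $w_i>0$ with $\sum_i w_i<\infty$; and $d(x,y):=\sum_{i=1}^\infty w_i\,d_{\theta_i}(x,y)$. A geodesic line of $(P,d)$ is the image of an isometric map $\mathbb{R}\to P$; geodesically complete means that any two points of $P$ are joined by a geodesic segment and every geodesic segment extends to a geodesic line. *)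

(* Defs.v *)
From HB Require Import structures.
From mathcomp Require Export all_boot all_order all_algebra.
From mathcomp Require Export all_classical all_reals all_analysis.
Export Order.TTheory GRing.Theory Num.Theory.
Export numFieldNormedType.Exports.

Set Implicit Arguments.
Unset Strict Implicit.
Unset Printing Implicit Defensive.

#[export] Set Implicit Arguments.
#[export] Unset Strict Implicit.
#[export] Unset Printing Implicit Defensive.

Local Open Scope classical_set_scope.
Local Open Scope ring_scope.

(** Metric notions relative to a function [d] on a subset [A] of a type: they
    are used both for [X] itself ([d := mdist], [A := setT]) and for [(P, d)],
    where [d] is only meaningful on [P].  A curve defined on an interval is a
    function on [R] whose values outside the interval are irrelevant. *)
Section metric_notions.
Context {R : realType} {T : Type}.
Implicit Types (d : T -> T -> R) (A : set T) (c : R -> T).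

Definition metric_on d A : Prop :=
  [/\ forall x y, A x -> A y -> 0 <= d x y,
      forall x y, A x -> A y -> (d x y = 0 <-> x = y),
      forall x y, A x -> A y -> d x y = d y x &
      forall x y z, A x -> A y -> A z -> d x z <= d x y + d y z].

Definition isometric_map d A (I : set R) c : Prop :=
  (forall t, I t -> A (c t)) /\
  (forall s t, I s -> I t -> d (c s) (c t) = `|s - t|).

Definition geodesic_segment d A (l : R) c : Prop :=
  0 <= l /\ isometric_map d A `[0, l] c.

Definition segment_joins d A (x y : T) (l : R) c : Prop :=
  [/\ geodesic_segment d A l c, c 0 = x & c l = y].

Definition geodesic_line d A c : Prop := isometric_map d A setT c.

Definition geodesic_space d A : Prop :=
  forall x y, A x -> A y -> exists l c, segment_joins d A x y l c.

Definition geodesically_complete d A : Prop :=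
  geodesic_space d A /\
  forall l c, geodesic_segment d A l c ->
    exists c', geodesic_line d A c' /\ forall t, 0 <= t <= l -> c' t = c t.

End metric_notions.

(** [f] is a homeomorphism from [T] onto the subspace [B] of [U]. *)
Definition homeomorphism_onto (T U : topologicalType) (f : T -> U)
    (B : set U) : Prop :=
  [/\ continuous f, range f = B &
      exists g : U -> T, cancel f g /\ {within B, continuous g}].

Definition homeomorphic_to (T U : topologicalType) (B : set U) : Prop :=
  exists f : T -> U, homeomorphism_onto f B.

Section plane.
Variable R : realType.

Definition unit_circle : set (R * R) :=
  [set z | z.1 ^+ 2 + z.2 ^+ 2 = 1].

Definition closed_unit_disk : set (R * R) :=
  [set z | z.1 ^+ 2 + z.2 ^+ 2 <= 1].

Definition cw_rotation (s : R) (u : R * R) : R * R :=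
  (cos s * u.1 + sin s * u.2, cos s * u.2 - sin s * u.1).

(** For [u], [v] on the unit circle: the Euclidean length, in [[0, 2 pi[], of
    the arc running clockwise from [u] to [v]. *)
Definition cw_length (u v : R * R) : R :=
  xget 0 [set s | 0 <= s < 2 * pi /\ cw_rotation s u = v].

End plane.

Section boundary_at_infinity.
Context {R : realType}.
Variable X : metricType R.
Implicit Types c : R -> X.

Definition geodesic_ray c : Prop := isometric_map mdist setT `[0, +oo[ c.

Definition asymptotic c c' : Prop :=
  exists M : R, forall t, 0 <= t -> mdist (c t) (c' t) <= M.

Definition asymptoty_class c : set (R -> X) :=
  [set c' | geodesic_ray c' /\ asymptotic c c'].

Record boundary : Type := Boundary {
  rays : set (R -> X);
  _ : exists2 c, geodesic_ray c & rays = asymptoty_class c }.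

HB.instance Definition _ := gen_eqMixin boundary.
HB.instance Definition _ := gen_choiceMixin boundary.

(** The set [X ∪ ∂X]. *)
Variant compactification : Type :=
  | inner of X
  | ideal of boundary.

HB.instance Definition _ := gen_eqMixin compactification.
HB.instance Definition _ := gen_choiceMixin compactification.

(** Functions on [R] with the topology of uniform convergence on the compact
    subsets of [[0, +oo[]; values at negative parameters do not matter. *)
Definition curves : Type :=
  {family [set K : set R | compact K /\ K `<=` `[0, +oo[], R -> X}.

HB.instance Definition _ := Uniform.on curves.

Definition ray_to (c : curves) (xi : boundary) : Prop := rays xi c.

(** Geodesic segments are continued by their endpoint, so that a segment and a
    ray can be compared on all of [[0, +oo[]. *)
Definition leads_to (c : curves) (z : compactification) : Prop :=
  match z with
  | inner x => exists l, geodesic_segment mdist setT l c /\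
                         forall t, l <= t -> c t = x
  | ideal xi => ray_to c xi
  end.

(** Quotient topology on [Q], for the map sending a curve [c] in the domain of
    the functional relation [e] to the point [z] with [e c z]. *)
Definition quotient_open_by (Q : Type) (e : curves -> Q -> Prop) (U : set Q) :
    Prop :=
  exists2 V : set curves, open V & forall c z, e c z -> (V c <-> U z).

Section quotient_open_by_theory.
Variables (Q : Type) (e : curves -> Q -> Prop).

Lemma quotient_open_byT : quotient_open_by e setT.
Proof. by exists setT; [exact: openT|]. Qed.

Lemma quotient_open_byI : setI_closed (quotient_open_by e).
Proof.
move=> A B [V oV VA] [W oW WB]; exists (V `&` W); first exact: openI.
by move=> c z ez; split=> -[? ?]; split;
  solve [exact/(VA _ _ ez)|exact/(WB _ _ ez)].
Qed.

Lemma quotient_open_by_bigU (I : Type) (f : I -> set Q) :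
  (forall i, quotient_open_by e (f i)) -> quotient_open_by e (\bigcup_i f i).
Proof.
move=> H; have /choice[V HV] : forall i, exists V : set curves,
    open V /\ forall c z, e c z -> (V c <-> f i z).
  by move=> i; have [V oV VE] := H i; exists V.
exists (\bigcup_i V i); first by apply: bigcup_open => i _; exact: (HV i).1.
move=> c z ez; split=> -[i _ ?]; exists i => //; exact/((HV i).2 _ _ ez).
Qed.

End quotient_open_by_theory.

HB.instance Definition _ := isOpenTopological.Build boundary
  (quotient_open_byT ray_to) (@quotient_open_byI _ ray_to)
  (@quotient_open_by_bigU _ ray_to).

HB.instance Definition _ := isOpenTopological.Build compactification
  (quotient_open_byT leads_to) (@quotient_open_byI _ leads_to)
  (@quotient_open_by_bigU _ leads_to).

Definition pos_end c (xi : boundary) : Prop := rays xi c.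
Definition neg_end c (xi : boundary) : Prop := rays xi (fun t => c (- t)).

Definition line_joins (xi eta : boundary) c : Prop :=
  [/\ geodesic_line mdist setT c, neg_end c xi & pos_end c eta].

Definition proper_space : Prop :=
  forall (x : X) (r : R), compact [set y | mdist x y <= r].

Definition G1 : Prop :=
  (forall x y : X, exists l c, segment_joins mdist setT x y l c /\
    forall l' c', segment_joins mdist setT x y l' c' ->
      l' = l /\ forall t, 0 <= t <= l -> c' t = c t) /\
  (forall (x y : X) l c, x <> y -> segment_joins mdist setT x y l c ->
    exists! c', geodesic_line mdist setT c' /\
                forall t, 0 <= t <= l -> c' t = c t).

(** Here, unlike in [G1], a line has no distinguished parametrization and is
    identified with its image. *)
Definition G2 : Prop :=
  forall xi eta : boundary, xi <> eta ->
    exists! L : set X, exists2 c, line_joins xi eta c & L = range c.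

Definition G3 : Prop :=
  forall (x : X) (xi : boundary), exists c, [/\ ray_to c xi, c 0 = x &
    forall c', ray_to c' xi -> c' 0 = x -> forall t, 0 <= t -> c' t = c t].

Definition segment (x y : X) : set X :=
  [set z | exists l c, segment_joins mdist setT x y l c /\ (c @` `[0, l]) z].

Definition line_between (xi eta : boundary) : set X :=
  [set z | exists2 c, line_joins xi eta c & range c z].

Definition convex_set (P : set X) : Prop :=
  forall x y, P x -> P y -> segment x y `<=` P.

Definition bounded_subset (P : set X) : Prop :=
  exists (x : X) (r : R), forall y, P y -> mdist x y <= r.

(** [sides] lists the endpoints of the (nondegenerate) sides of [P]. *)
Definition convex_polygon (P : set X) (sides : seq (X * X)) : Prop :=
  [/\ P !=set0, open P, bounded_subset P, convex_set P &
      (forall s, s \in sides -> s.1 <> s.2) /\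
      closure P `\` interior P =
        \bigcup_(s in [set s | s \in sides]) segment s.1 s.2].

Definition contains_side_ends (Theta : set boundary) (sides : seq (X * X)) :
    Prop :=
  forall s c xi, s \in sides -> geodesic_line mdist setT c ->
    segment s.1 s.2 `<=` range c -> pos_end c xi \/ neg_end c xi -> Theta xi.

(** [x_theta] *)
Definition opposite_end (x : X) (theta : boundary) : boundary :=
  xget theta [set zeta | exists2 c, line_joins zeta theta c & range c x].

End boundary_at_infinity.

Section polygon_distance.
Context {R : realType} {X : metricType R}.
Variables (h : compactification X -> R * R) (P : set X).
Implicit Types (theta xi eta zeta : boundary X) (x y : X).

Definition cw_dist xi eta : R := cw_length (h (ideal xi)) (h (ideal eta)).

Definition cw_arc xi eta : set (boundary X) :=
  [set zeta | cw_dist xi zeta <= cw_dist xi eta].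

(** The closed arc between [xi] and [eta] not containing [theta], and its
    length, for [theta] distinct from [xi] and [eta]. *)
Definition arc_avoiding theta xi eta : set (boundary X) :=
  if `[< cw_arc xi eta theta >] then cw_arc eta xi else cw_arc xi eta.

Definition arc_length theta xi eta : R :=
  if `[< cw_arc xi eta theta >] then cw_dist eta xi else cw_dist xi eta.

Definition clockwise xi eta zeta : Prop :=
  0 < cw_dist xi eta < cw_dist xi zeta.

(** The trace on [X] of the region of [X ∪ ∂X] bounded by the lines
    [(theta, xi)], [(theta, eta)] and the arc from [xi] to [eta] avoiding
    [theta]: the component, in the complement of the two closed-up lines, that
    borders on this arc. *)
Definition region theta xi eta : set X :=
  let lines := @inner R X @` (line_between theta xi `|` line_between theta eta)
               `|` @ideal R X @` [set theta; xi; eta] in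
  [set x | exists zeta,
     [/\ arc_avoiding theta xi eta zeta, zeta <> xi, zeta <> eta &
         connected_component (~` lines) (ideal zeta) (inner x)]].

Definition supports theta xi eta : Prop :=
  [/\ clockwise theta eta xi,
      P `<=` region theta xi eta &
      forall xi' eta', xi' <> theta -> eta' <> theta ->
        P `<=` region theta xi' eta' ->
        region theta xi' eta' `<=` region theta xi eta ->
        region theta xi' eta' = region theta xi eta].

(** [(xi_theta, eta_theta)] *)
Definition support_ends theta : boundary X * boundary X :=
  xget (theta, theta) [set p | supports theta p.1 p.2].

Definition dist_theta theta x y : R :=
  let xi := (support_ends theta).1 in
  let eta := (support_ends theta).2 in
  let len := arc_length theta in
  let log_ratio a b := ln (len eta a * len xi b / (len eta b * len xi a)) in
  let xt := opposite_end x theta in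
  let yt := opposite_end y theta in
  if cw_dist eta yt <= cw_dist eta xt then log_ratio xt yt else log_ratio yt xt.

Variables (theta_ : nat -> boundary X) (w : nat -> R).

Definition dist_summand x y (i : nat) : R := w i * dist_theta (theta_ i) x y.

Definition polygon_dist x y : R := limn (series (dist_summand x y)).

End polygon_distance.

(* Main.v *)
(* Through every point x passes exactly one line ending at a given ideal point
   theta; let angle theta x be the clockwise distance from theta to its other
   end.  Since limits of geodesic lines are geodesic lines, this is continuous
   in (theta, x), and it extends continuously to the ideal points other than
   theta.  Along a line ending at theta it is constant; along any other line it
   is injective, hence strictly monotone.  So regions are preimages of intervals
   under the angle, no Jordan curve theorem is needed, and dist_theta x y is
   |F x - F y|, where F := log_angle theta identifies the interval of angles of
   P with R.

   Hence d is a sum of pseudometrics that are all additive along lines, and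
   lines of X are geodesics of (P, d).  They have infinite length in P, because
   a line leaves P through a side, and seen from an end of the line carrying that
   side the exit point has an extremal angle.  Conversely, equality in the
   triangle inequality puts the angle of y between those of x and z for a dense
   set of theta; letting theta tend to an end of the line xz forces y on it. *)
Require Import Defs.
From mathcomp Require Import ring lra.

(** The topology of [X ∪ ∂X] is a quotient of a space of curves, so its neighbourhoods are awkward
    to handle directly. Limits are therefore taken along ultrafilters: properness makes lines
    through converging points converge pointwise at every parameter at once, pointwise convergence
    of 1-Lipschitz curves passes to the points they lead to, and a limit is identified by its image
    in the plane, where limits are unique.

    Continuity of the angle at ideal points is the delicate case. It cannot be avoided, because
    [region] is defined by a component that contains an ideal point.

    Two estimates control the infinite sum. For fixed [x], [log_angle] is bounded uniformly in the
    ideal point, so summability of the weights gives convergence. Along a line, the remainder of the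
    series for two intermediate points is dominated by the remainder for the extreme ones, so [d] is
    continuous along lines. Together with unboundedness this lets [c ∩ P] be parametrized by [d]-arc
    length over all of the real line. *)

Local Open Scope classical_set_scope.
Local Open Scope ring_scope.

(** * Limits along ultrafilters *)

Section ultrafilters.
Context {I : Type} (G : set_system I) {GU : UltraFilter G}.

Lemma ultra_fmap (T : Type) (f : I -> T) : UltraFilter (f @ G).
Proof.
split; first exact: fmap_proper_filter.
move=> H HF sGH; rewrite eqEsubset; split => // A HA.
have [//|nA] := in_ultra_setVsetC (f @^-1` A) GU.
have HnA : H (~` A) by exact: sGH.
by have /filter_ex[? []] : H (A `&` ~` A) by exact: filterI.
Qed.

Lemma ultra_cvg_compact (T : topologicalType) (K : set T) (f : I -> T) :
  compact K -> G [set i | K (f i)] -> exists2 p, K p & f @ G --> p.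
Proof.
rewrite compact_ultra => cK GK; have := cK _ (ultra_fmap f) GK.
by move=> [p [Kp fp]]; exists p.
Qed.

(** Compactness of the extended line. It replaces the extraction of subsequences for positions on
    moving lines. *)
Lemma ultra_real_cvg (R : realType) (u : I -> R) :
  [\/ exists l : R, u @ G --> l, forall M, G [set i | M < u i] |
      forall M, G [set i | u i < M]].
Proof.
have [Hp|] := pselect (forall M, G [set i | M < u i]); first exact: Or32.
move=> /existsNP[M nM].
have [Hn|] := pselect (forall M, G [set i | u i < M]); first exact: Or33.
move=> /existsNP[m nm]; apply: Or31.
have [//|GM] := in_ultra_setVsetC [set i | M < u i] GU.
have [//|Gm] := in_ultra_setVsetC [set i | u i < m] GU.
have [|l _ ul] := @ultra_cvg_compact R `[m, M]%classic u (@segment_compact _ _ _).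
  apply: filterS (filterI GM Gm) => i /= [/negP + /negP].
  by rewrite -!leNgt in_itv /= => -> ->.
by exists l.
Qed.

End ultrafilters.

(** Reduces continuity to ultrafilters, along which compactness provides limits outright. If
    convergence failed at [U], an ultrafilter finer than [F] would contain the complement of the
    preimage of [U]. *)
Lemma cvg_ultra (I : Type) (F : set_system I) {FF : Filter F}
    (T : topologicalType) (f : I -> T) (l : T) :
  (forall G, UltraFilter G -> F `<=` G -> f @ G --> l) -> f @ F --> l.
Proof.
move=> H U Ul; apply: contrapT => nFU.
(* The filter generated by [F] and the complement of the preimage of [U]. *)
pose K : set_system I := [set A | F ((f @^-1` U) `|` A)].
have FK : F `<=` K by move=> A FA; apply: filterS FA => i; right.
have KP : ProperFilter K.
  split; first by rewrite /K /= setU0.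
  split; first by apply: FK; exact: filterT.
    move=> A B; rewrite /K /= => KA KB; apply: filterS (filterI KA KB).
    by move=> i [[Ui|Ai] [Vi|Bi]]; [left|left|left|right].
  by move=> A B AB; rewrite /K /=; apply: filterS => i [?|/AB]; [left|right].
have [G [GU KG]] := ultraFilterLemma KP.
have GfU : G (f @^-1` U) by apply: (H G GU) => // A /FK/KG.
have GnU : G (~` (f @^-1` U)).
  by apply: KG; rewrite /K /= setUv; exact: filterT.
have /filter_ex[i [Ui /(_ Ui)]] : G ((f @^-1` U) `&` ~` (f @^-1` U)).
  exact: filterI.
by [].
Qed.

Lemma cvg_unique_real (R : realType) (I : Type) (F : set_system I)
    {FF : ProperFilter F} (f : I -> R) (a b : R) :
  f @ F --> a -> f @ F --> b -> a = b.
Proof. by move=> fa fb; apply: (cvg_unique _ fa fb); exact: norm_hausdorff. Qed.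

(** * Arcs of the unit circle *)

Section circle_arcs.
Context {R : realType}.
Implicit Types (u v : R * R) (s t : R).

Lemma cw_rotationD s t u : cw_rotation s (cw_rotation t u) = cw_rotation (s + t) u.
Proof. by rewrite /cw_rotation /= cosD sinD; congr pair; ring. Qed.

Lemma cw_rotation0 u : cw_rotation 0 u = u.
Proof. by case: u => a b; rewrite /cw_rotation /= cos0 sin0; congr pair; ring. Qed.

Lemma cw_rotation2pi u : cw_rotation (2 * pi) u = u.
Proof.
case: u => a b; rewrite /cw_rotation /= mulr_natl cos2pi sin2pi.
by congr pair; ring.
Qed.

Lemma cw_rotation_circle s u : unit_circle u -> unit_circle (cw_rotation s u).
Proof.
rewrite /unit_circle /cw_rotation /= => u1; have := cos2Dsin2 s => cs.
rewrite -[RHS](mulr1 1) -{1}cs -u1; ring.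
Qed.

Lemma cos_eq1 (d : R) : 0 <= d < 2 * pi -> cos d = 1 -> d = 0.
Proof.
move=> /andP[d0 d2] c1; have p0 := @pi_gt0 R.
have [dp|dp] := leP d pi.
  by apply: cos_inj; rewrite ?in_itv /= ?c1 ?cos0 ?lexx ?d0 ?dp ?ltW.
have c2 : cos (2 * pi - d) = 1.
  by rewrite mulr_natl cosB cos2pi sin2pi c1 mulr1 mul0r addr0.
suff : 2 * pi - d = 0 by move=> ?; lra.
by apply: cos_inj; rewrite ?in_itv /= ?c2 ?cos0 //; apply/andP; split; lra.
Qed.

Lemma cw_rotation_inj u s t : unit_circle u -> 0 <= s < 2 * pi ->
  0 <= t < 2 * pi -> cw_rotation s u = cw_rotation t u -> s = t.
Proof.
move=> u1; wlog st : s t / t <= s => [H hs ht e|].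
  by have [/H|/ltW/H] := leP t s; [exact|move=> K; exact/esym/K].
move=> hs ht /(congr1 (cw_rotation (- t))); rewrite !cw_rotationD addNr cw_rotation0.
move: u1; rewrite /unit_circle /cw_rotation; case: u => a b /= ab [e1 e2].
apply/eqP; rewrite -subr_eq0 addrC; apply/eqP/cos_eq1; first lra.
(* The scalar product of a unit vector with its rotation by [s - t] is [cos (s - t)]; here the
   rotation fixes the vector. *)
have : (cos (- t + s) * a + sin (- t + s) * b) * a +
       (cos (- t + s) * b - sin (- t + s) * a) * b = 1.
  by rewrite e1 e2 -ab; ring.
move=> <-; rewrite -[LHS]mulr1 -ab; ring.
Qed.

Lemma cw_rotation_ex u v : unit_circle u -> unit_circle v ->
  exists s, 0 <= s < 2 * pi /\ cw_rotation s u = v.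
Proof.
have p0 := @pi_gt0 R.
case: u v => [a b] [c d]; rewrite /unit_circle /= => ab cd.
(* Scalar product and determinant of the two vectors: cosine and sine of the clockwise angle sought.
   [acos C] finds it up to a reflection, settled by the sign of [S]. *)
pose C := a * c + b * d; pose S := c * b - d * a.
have CS : C ^+ 2 + S ^+ 2 = 1.
  rewrite -[RHS](mulr1 1) -{1}ab -cd /C /S; ring.
have Cb : -1 <= C <= 1.
  have : C ^+ 2 <= 1 by rewrite -CS lerDl sqr_ge0.
  move=> ?; apply/andP; split; nra.
suff [s [hs cs ss]] : exists s, [/\ 0 <= s < 2 * pi, cos s = C & sin s = S].
  exists s; split => //; rewrite /cw_rotation /= cs ss /C /S.
  congr pair; [rewrite -[RHS]mulr1 -ab|rewrite -[RHS]mulr1 -ab]; ring.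
have a0 := acos_ge0 Cb; have ap := acos_lepi Cb.
have cC : cos (acos C) = C by rewrite acosK // in_itv.
have sC : sin (acos C) = `|S|.
  by rewrite sin_acos // (_ : 1 - C ^+ 2 = S ^+ 2) ?sqrtr_sqr // -CS; ring.
have [S0|S0] := leP 0 S.
  by exists (acos C); rewrite cC sC ger0_norm //; split => //; lra.
exists (2 * pi - acos C); split.
- have : acos C != 0 by apply/eqP => E; move: sC; rewrite E sin0 ltr0_norm //; lra.
  move=> ne; have : 0 < acos C by rewrite lt_neqAle eq_sym ne a0.
  move=> ?; lra.
- by rewrite mulr_natl cosB cos2pi sin2pi cC mul1r mul0r addr0.
- by rewrite mulr_natl sinB cos2pi sin2pi sC ltr0_norm // mul0r sub0r mul1r opprK.
Qed.

Lemma cw_lengthP u v : unit_circle u -> unit_circle v ->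
  0 <= cw_length u v < 2 * pi /\ cw_rotation (cw_length u v) u = v.
Proof.
move=> u1 v1; have [s hs] := cw_rotation_ex u1 v1.
by rewrite /cw_length; case: xgetP => [t _ //|/(_ s)].
Qed.

Lemma cw_lengthE u v s : unit_circle u -> 0 <= s < 2 * pi ->
  cw_rotation s u = v -> cw_length u v = s.
Proof.
move=> u1 hs e; have v1 : unit_circle v by rewrite -e; exact: cw_rotation_circle.
have [h1 h2] := cw_lengthP u1 v1.
by apply: (cw_rotation_inj u1) => //; rewrite h2 e.
Qed.

Lemma cw_lengthxx u : unit_circle u -> cw_length u u = 0.
Proof.
move=> u1; apply: cw_lengthE => //; last exact: cw_rotation0.
by rewrite lexx mulr_gt0 // pi_gt0.
Qed.

Lemma cw_length_gt0 u v : unit_circle u -> unit_circle v -> u <> v ->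
  0 < cw_length u v.
Proof.
move=> u1 v1 uv; have [/andP[h _] e] := cw_lengthP u1 v1.
rewrite lt_neqAle h andbT eq_sym; apply/eqP => E; apply: uv.
by rewrite -e E cw_rotation0.
Qed.

(** The circle is cut at [o] and arcs are measured in one coordinate; a full turn is added when the
    arc runs over the cut. *)
Lemma cw_length_sub o u v : unit_circle o -> unit_circle u -> unit_circle v ->
  cw_length u v = if cw_length o u <= cw_length o v
    then cw_length o v - cw_length o u
    else cw_length o v - cw_length o u + 2 * pi.
Proof.
move=> o1 u1 v1; have [] := cw_lengthP o1 u1; have [] := cw_lengthP o1 v1.
move: (cw_length o u) (cw_length o v) => a b hb eb ha ea.
apply: cw_lengthE => //; first by case: ifPn; rewrite -?ltNge => ?; lra.
rewrite -ea cw_rotationD; case: ifPn => _; first by rewrite subrK.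
by rewrite addrAC subrK addrC -cw_rotationD eb cw_rotation2pi.
Qed.

(** The length jumps between 0 and [2 * pi] across [u = v], hence [u <> v]. A limit [s] of the
    lengths exists in [[0, 2 * pi]] and rotates [u] to [v]; [s = 2 * pi] would force [u = v]. *)
Lemma cw_length_cvg (I : Type) (G : set_system I) (GU : UltraFilter G)
    (us vs : I -> R * R) u v :
  unit_circle u -> unit_circle v -> u <> v ->
  (forall i, unit_circle (us i)) -> (forall i, unit_circle (vs i)) ->
  us @ G --> u -> vs @ G --> v ->
  cw_length (us i) (vs i) @[i --> G] --> cw_length u v.
Proof.
move=> u1 v1 uv us1 vs1 usu vsv.
have [|s /=] := @ultra_cvg_compact _ _ GU R `[0, 2 * pi]%classic
    (fun i => cw_length (us i) (vs i)) (@segment_compact _ _ _).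
  apply: filterE => i /=; have [/andP[h1 h2] _] := cw_lengthP (us1 i) (vs1 i).
  by rewrite in_itv /= h1 ltW.
rewrite in_itv /= => /andP[s0 s2] cs.
have rs : cw_rotation (cw_length (us i) (vs i)) (us i) @[i --> G] --> cw_rotation s u.
  have c1 : cos (cw_length (us i) (vs i)) @[i --> G] --> cos s.
    exact: (continuous_cvg _ (@continuous_cos R s) cs).
  have c2 : sin (cw_length (us i) (vs i)) @[i --> G] --> sin s.
    exact: (continuous_cvg _ (@continuous_sin R s) cs).
  have u1c : (us i).1 @[i --> G] --> u.1 by apply: (cvg_comp us fst usu); exact: cvg_fst.
  have u2c : (us i).2 @[i --> G] --> u.2 by apply: (cvg_comp us snd usu); exact: cvg_snd.
  have p1 : cos (cw_length (us i) (vs i)) * (us i).1 +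
      sin (cw_length (us i) (vs i)) * (us i).2 @[i --> G] -->
      (cw_rotation s u).1 by exact: (cvgD (cvgM c1 u1c) (cvgM c2 u2c)).
  have p2 : cos (cw_length (us i) (vs i)) * (us i).2 -
      sin (cw_length (us i) (vs i)) * (us i).1 @[i --> G] -->
      (cw_rotation s u).2 by exact: (cvgB (cvgM c1 u2c) (cvgM c2 u1c)).
  exact: (cvg_pair p1 p2).
have e : cw_rotation s u = v.
  apply: (cvg_unique _ rs); first exact: norm_hausdorff.
  rewrite (_ : (fun i => _) = vs) //; apply/funext => i.
  by have [_ ->] := cw_lengthP (us1 i) (vs1 i).
suff -> : cw_length u v = s by [].
apply: cw_lengthE => //; rewrite s0 lt_neqAle s2 andbT.
by apply/eqP => E; apply: uv; rewrite -e E cw_rotation2pi.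
Qed.

End circle_arcs.

(** * Geodesic lines and their ends *)

Section lines.
Context {R : realType} {X : metricType R}.
Implicit Types (c g : R -> X) (x y : X) (xi eta theta zeta : boundary X).

Lemma lineP c :
  geodesic_line mdist setT c <-> forall s t, mdist (c s) (c t) = `|s - t|.
Proof. by split=> [[_ H] s t|H]; [exact: H|split]. Qed.

Lemma line_shift c b : geodesic_line mdist setT c ->
  geodesic_line mdist setT (fun t => c (t + b)).
Proof.
by move/lineP => H; apply/lineP => s t; rewrite H; congr Num.norm; ring.
Qed.

Lemma line_rev c : geodesic_line mdist setT c ->
  geodesic_line mdist setT (fun t => c (- t)).
Proof.
by move/lineP => H; apply/lineP => s t; rewrite H distrC; congr Num.norm; ring.
Qed.

Lemma line_rev_shift c b : geodesic_line mdist setT c ->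
  geodesic_line mdist setT (fun t => c (- t + b)).
Proof. by move=> /(line_shift b)/line_rev. Qed.

Lemma ray_of_line c : geodesic_line mdist setT c -> geodesic_ray c.
Proof. by move/lineP => H; split=> // s t _ _; rewrite H. Qed.

Lemma ray_isometric c s t : geodesic_ray c -> 0 <= s -> 0 <= t ->
  mdist (c s) (c t) = `|s - t|.
Proof. by move=> [_ H] s0 t0; apply: H; rewrite /= in_itv /= ?s0 ?t0. Qed.

Lemma line_segment c a l : geodesic_line mdist setT c -> 0 <= l ->
  segment_joins mdist setT (c a) (c (a + l)) l (fun t => c (a + t)).
Proof.
move=> /lineP H l0; split=> //; last by rewrite addr0.
by split => //; split => // s t _ _; rewrite H; congr Num.norm; ring.
Qed.

Lemma asymptotic_sym c c' : asymptotic c c' -> asymptotic c' c.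
Proof. by move=> [M H]; exists M => t /H; rewrite metric_sym. Qed.

Lemma asymptotic_trans c1 c2 c3 :
  asymptotic c1 c2 -> asymptotic c2 c3 -> asymptotic c1 c3.
Proof.
move=> [M H] [N K]; exists (M + N) => t t0.
exact: le_trans (metric_triangle _ _ _) (lerD (H _ t0) (K _ t0)).
Qed.

Lemma raysE xi c : rays xi c -> geodesic_ray c /\ rays xi = asymptoty_class c.
Proof.
case: xi => S [c0 c0r /= SE]; rewrite SE => -[cr cc0]; split=> //.
apply/seteqP; split => c' [c'r c'0]; split => //.
  exact: asymptotic_trans (asymptotic_sym cc0) c'0.
exact: asymptotic_trans cc0 c'0.
Qed.

Lemma boundary_eq xi eta c : rays xi c -> rays eta c -> xi = eta.
Proof.
move=> /raysE[_ Ex] /raysE[_ Ee]; have : rays xi = rays eta by rewrite Ex Ee.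
case: xi eta {Ex Ee} => [S HS] [S' HS'] /= E; subst S'.
by congr Boundary; exact: Prop_irrelevance.
Qed.

Lemma ray_end c : geodesic_ray c -> exists xi, rays xi c.
Proof.
move=> cr; have H : exists2 c', geodesic_ray c' & asymptoty_class c = asymptoty_class c'.
  by exists c.
exists (Boundary H); split => //; exists 0 => t _; by rewrite mdistxx.
Qed.

Lemma rays_asymptotic xi c c' :
  rays xi c -> geodesic_ray c' -> asymptotic c c' -> rays xi c'.
Proof. by move=> /raysE[_ ->] cr a; split. Qed.

Lemma rays_eq xi c c' : rays xi c -> (forall t, 0 <= t -> c' t = c t) -> rays xi c'.
Proof.
move=> xc E; have [cr _] := raysE xc; apply: (rays_asymptotic xc).
  split=> // s t; rewrite /= !in_itv /= !andbT => s0 t0.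
  by rewrite !E // (ray_isometric cr).
by exists 0 => t t0; rewrite E // mdistxx.
Qed.

Lemma pos_end_ex c : geodesic_line mdist setT c -> exists xi, pos_end c xi.
Proof. by move=> /ray_of_line/ray_end. Qed.

Lemma neg_end_ex c : geodesic_line mdist setT c -> exists xi, neg_end c xi.
Proof. by move=> /line_rev/ray_of_line/ray_end. Qed.

Lemma pos_end_shift c xi b : geodesic_line mdist setT c -> pos_end c xi ->
  pos_end (fun t => c (t + b)) xi.
Proof.
move=> cl ce; apply: (rays_asymptotic ce); first exact/ray_of_line/line_shift.
by exists `|b| => t _; have /lineP -> := cl; rewrite opprD addNKr normrN.
Qed.

Lemma neg_end_shift c xi b : geodesic_line mdist setT c -> neg_end c xi ->
  neg_end (fun t => c (t + b)) xi.
Proof.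
move=> cl ce; rewrite /neg_end.
have := @pos_end_shift (fun t => c (- t)) xi (- b) (line_rev cl) ce.
by congr (rays _ _); apply/funext => t; congr c; ring.
Qed.

Lemma neg_end_rev c xi : pos_end c xi -> neg_end (fun t => c (- t)) xi.
Proof.
by rewrite /neg_end; congr (rays _ _); apply/funext => t; rewrite opprK.
Qed.

(** The points [c t] and [c (- t)] are at distance [2 * t], so the two half-lines are not
    asymptotic. *)
Lemma line_ends_neq c xi eta : geodesic_line mdist setT c ->
  pos_end c xi -> neg_end c eta -> xi <> eta.
Proof.
move=> /lineP cl /raysE[_ Ex] ne xe; subst eta.
move: ne; rewrite /neg_end Ex => -[_ [M H]].
have M0 := normr_ge0 M; have N0 : 0 <= `|M| + 1 by lra.
have := H _ N0; rewrite cl [X in X <= _]ger0_norm; last lra.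
by have := ler_norm M; lra.
Qed.

End lines.

(** * Consequences of (G1), (G2) and (G3) *)

Section uniqueness_of_lines.
Context {R : realType} {X : metricType R}.
Hypotheses (X_G1 : G1 X) (X_G2 : G2 X) (X_G3 : G3 X).
Implicit Types (c g : R -> X) (x y : X) (xi eta theta zeta : boundary X).

(** Uniqueness of segments makes the lines agree on [[0, l]], and uniqueness of extensions makes
    them agree everywhere. *)
Lemma line_uniq0 c c' l : geodesic_line mdist setT c ->
  geodesic_line mdist setT c' -> 0 < l -> c 0 = c' 0 -> c l = c' l -> c = c'.
Proof.
move=> cl c'l l0 e0 el.
have sc : segment_joins mdist setT (c 0) (c l) l c.
  by have := line_segment 0 cl (ltW l0); rewrite add0r; congr segment_joins;
     apply/funext => t; rewrite add0r.
have sc' : segment_joins mdist setT (c 0) (c l) l c'.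
  rewrite e0 el; have := line_segment 0 c'l (ltW l0); rewrite add0r.
  by congr segment_joins; apply/funext => t; rewrite add0r.
have [L [c0 [_ U]]] := X_G1.1 (c 0) (c l).
have [EL Ec] := U _ _ sc; have [_ Ec'] := U _ _ sc'; rewrite -EL in Ec Ec'.
have ne : c 0 <> c l.
  move=> E; have /lineP/(_ 0 l) := cl.
  by rewrite E mdistxx sub0r normrN gtr0_norm // => E'; move: l0; rewrite -E' ltxx.
have [c'' [_ V]] := X_G1.2 _ _ _ _ ne sc.
rewrite -(V c) //; apply: V; split => // t tl.
by rewrite Ec' // Ec.
Qed.

Lemma line_uniq c c' s t : geodesic_line mdist setT c ->
  geodesic_line mdist setT c' -> s <> t -> c s = c' s -> c t = c' t -> c = c'.
Proof.
move=> cl c'l; wlog st : s t / s < t => [H ne es et|_ es et].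
  have [ts|ts|//] := ltgtP s t; first exact: (H s t).
  by apply: (H t s) => // E; apply: ne.
have E := @line_uniq0 (fun u => c (u + s)) (fun u => c' (u + s)) (t - s)
  (line_shift s cl) (line_shift s c'l).
have {}E : (fun u => c (u + s)) = (fun u => c' (u + s)).
  by apply: E; rewrite ?subr_gt0 ?add0r ?subrK.
apply/funext => u; have := congr1 (fun f => f (u - s)) E.
by rewrite /= subrK.
Qed.

(** Equal distances give [s - t = ± (s' - t')]; the sign decides between a translation and a
    reflection. *)
Lemma line_reparam c c' s t s' t' : geodesic_line mdist setT c ->
  geodesic_line mdist setT c' -> s <> t -> c s = c' s' -> c t = c' t' ->
  (exists b, c' = fun u => c (u + b)) \/ (exists b, c' = fun u => c (- u + b)).
Proof.
move=> cl c'l st es et.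
have d : `|s - t| = `|s' - t'|.
  by have /lineP <- := cl; have /lineP <- := c'l; rewrite es et.
have st' : s' <> t'.
  move=> E; move: d; rewrite E subrr normr0 => /normr0_eq0/eqP.
  by rewrite subr_eq0 => /eqP.
have /orP[/eqP E|/eqP E] : (s - t == s' - t') || (s - t == - (s' - t')).
  by rewrite -eqr_norm2 d.
- left; exists (s - s'); apply/esym/(line_uniq _ c'l st').
  + exact: line_shift.
  + by rewrite addrC subrK.
  + by rewrite -et; congr c; move: E; lra.
- right; exists (s + s'); apply/esym/(line_uniq _ c'l st').
  + exact: line_rev_shift.
  + by rewrite addrC addrK.
  + by rewrite -et; congr c; move: E; lra.
Qed.

Lemma line_to x theta :
  exists c, [/\ geodesic_line mdist setT c, c 0 = x & pos_end c theta].
Proof.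
have [r [rt r0 _]] := X_G3 x theta; have [rr _] := raysE rt.
have seg l : 0 <= l -> segment_joins mdist setT (r 0) (r l) l r.
  move=> l0; split => //; split => //; split => // s t.
  by rewrite /= !in_itv /= => /andP[s0 _] /andP[t0 _]; rewrite (ray_isometric rr).
have ext l : 0 < l -> exists! c, geodesic_line mdist setT c /\
    forall t, 0 <= t <= l -> c t = r t.
  move=> l0; apply: (X_G1.2 (r 0) (r l)); last exact/seg/ltW.
  move=> E; have := ray_isometric rr (lexx 0) (ltW l0).
  by rewrite E mdistxx sub0r normrN gtr0_norm // => E'; move: l0; rewrite -E' ltxx.
have [c [[cl cE] cU]] := ext 1 ltr01.
(* The line extending [r] on [[0, 1 + t]] also extends it on [[0, 1]], hence is [c]. *)
have E t : 0 <= t -> c t = r t.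
  move=> t0; have [c' [[c'l c'E] _]] := ext (1 + t) ltac:(lra).
  rewrite (cU c'); first by apply: c'E; apply/andP; split; lra.
  by split => // u u1; apply: c'E; lra.
exists c; split => //; first by rewrite E.
exact: rays_eq rt E.
Qed.

Lemma line_to_uniq c c' theta : geodesic_line mdist setT c ->
  geodesic_line mdist setT c' -> c 0 = c' 0 ->
  pos_end c theta -> pos_end c' theta -> c = c'.
Proof.
move=> cl c'l e0 ce c'e; have [r [_ _ rU]] := X_G3 (c 0) theta.
by apply: (line_uniq0 cl c'l ltr01 e0); rewrite (rU c) // (rU c').
Qed.

Lemma opposite_endE c x theta zeta : geodesic_line mdist setT c -> range c x ->
  pos_end c theta -> neg_end c zeta -> opposite_end x theta = zeta.
Proof.
move=> cl [t _ ct] cp cn; rewrite /opposite_end; apply: xget_unique.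
  by exists c => //; exists t.
move=> eta [c' [c'l c'n c'p]] [t' _ c't'].
have E : (fun u => c' (u + t')) = (fun u => c (u + t)).
  apply: (@line_to_uniq _ _ theta); rewrite ?add0r ?ct ?c't' //;
    [exact: line_shift|exact: line_shift|exact: pos_end_shift|exact: pos_end_shift].
have := neg_end_shift t cl cn; rewrite -E => H.
exact: boundary_eq (neg_end_shift t' c'l c'n) H.
Qed.

Lemma line_to_opposite x theta : exists c, [/\ geodesic_line mdist setT c, c 0 = x,
  pos_end c theta & neg_end c (opposite_end x theta)].
Proof.
have [c [cl c0 cp]] := line_to x theta; have [z cz] := neg_end_ex cl.
by exists c; split => //; rewrite (opposite_endE cl _ cp cz) //; exists 0.
Qed.

Lemma opposite_end_neq x theta : opposite_end x theta <> theta.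
Proof.
have [c [cl _ cp cn]] := line_to_opposite x theta.
by move=> E; exact: (line_ends_neq cl cp cn).
Qed.

Lemma opposite_end_const c theta s t : geodesic_line mdist setT c ->
  pos_end c theta \/ neg_end c theta ->
  opposite_end (c s) theta = opposite_end (c t) theta.
Proof.
move=> cl [cp|cn].
  have [z cz] := neg_end_ex cl.
  have H u : opposite_end (c u) theta = z.
    by apply: (opposite_endE cl _ cp cz); exists u.
  by rewrite !H.
have [z cz] := pos_end_ex cl.
have H u : opposite_end (c u) theta = z.
  apply: (opposite_endE (line_rev cl)) => //; first by exists (- u) => //; rewrite opprK.
  exact: neg_end_rev.
by rewrite !H.
Qed.

Lemma opposite_end_range c x theta zeta : geodesic_line mdist setT c ->
  pos_end c theta -> neg_end c zeta -> opposite_end x theta = zeta -> range c x.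
Proof.
move=> cl cp cn E; have [c' [c'l c'0 c'p c'n]] := line_to_opposite x theta.
have [L [_ LU]] := X_G2 (@opposite_end_neq x theta).
have <- : range c' = range c.
  rewrite -(LU (range c')); first by apply: LU; exists c => //; split => //; rewrite E.
  by exists c' => //; split.
by exists 0.
Qed.

Lemma opposite_end_line x y theta : opposite_end x theta = opposite_end y theta ->
  exists c, [/\ geodesic_line mdist setT c, pos_end c theta, range c x & range c y].
Proof.
move=> E; have [c [cl c0 cp cn]] := line_to_opposite x theta.
exists c; split => //; first by exists 0.
exact: (opposite_end_range cl cp cn).
Qed.

(** Two points with the same opposite end lie on one line ending at [theta]. If distinct, they
    determine that line, so it is [c] up to parametrization and [c] ends at [theta]. *)
Lemma opposite_end_inj c theta s t : geodesic_line mdist setT c ->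
  ~ pos_end c theta -> ~ neg_end c theta ->
  opposite_end (c s) theta = opposite_end (c t) theta -> s = t.
Proof.
move=> cl np nn /opposite_end_line[c' [c'l c'p [s' _ es] [t' _ et]]].
apply: contrapT => st.
have st' : s' <> t'.
  move=> E; apply: st; have /lineP/(_ s t) := cl.
  by rewrite -es -et E mdistxx => /esym/normr0_eq0/eqP; rewrite subr_eq0 => /eqP.
have [[b E]|[b E]] := line_reparam c'l cl st' es et.
  by apply: np; rewrite E; exact: pos_end_shift.
apply: nn; rewrite E /neg_end; have := pos_end_shift b c'l c'p.
by congr (rays _ _); apply/funext => u; rewrite opprK.
Qed.

Lemma line_join_ex xi theta : xi <> theta -> exists c,
  [/\ geodesic_line mdist setT c, neg_end c xi & pos_end c theta].
Proof. by move=> /X_G2[L [[c [cl cn cp] _] _]]; exists c. Qed.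

Lemma line_through x y (theta : boundary X) : exists c,
  [/\ geodesic_line mdist setT c, c 0 = x & c (mdist x y) = y].
Proof.
(* For [x = y] there is no segment to extend; the ideal point [theta] supplies a line through the
   point. *)
have [->|/eqP ne] := eqVneq x y.
  have [c [cl c0 _]] := line_to y theta.
  by exists c; split => //; rewrite mdistxx.
have [l [c [sc _]]] := X_G1.1 x y; have [c' [[c'l E] _]] := X_G1.2 _ _ _ _ ne sc.
have [[l0 [_ ci]] c0 cl] := sc.
have E0 : c' 0 = x by rewrite E // lexx l0.
have El : c' l = y by rewrite E // lexx l0.
exists c'; split => //; suff -> : mdist x y = l by [].
by rewrite -E0 -El; have /lineP -> := c'l; rewrite sub0r normrN ger0_norm.
Qed.

Lemma segment_line c a b t : geodesic_line mdist setT c -> a <= t <= b ->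
  segment (c a) (c b) (c t).
Proof.
move=> cl /andP[ta tb]; exists (b - a), (fun t => c (a + t)); split.
  have := @line_segment _ _ c a (b - a) cl.
  by rewrite (addrC a (b - a)) subrK; apply; lra.
by exists (t - a); [rewrite /= in_itv /=; apply/andP; split; lra|congr c; ring].
Qed.

Lemma segment_sub_line c a b : geodesic_line mdist setT c -> a <= b ->
  segment (c a) (c b) `<=` c @` `[a, b].
Proof.
move=> cl ab z [l [c' [sc' [t /= tl <-]]]].
have sc := @line_segment _ _ c a (b - a) cl (ltac:(lra)).
rewrite (addrC a (b - a)) subrK in sc.
have [L [c0 [_ U]]] := X_G1.1 (c a) (c b).
have [EL Ec] := U _ _ sc; have [EL' Ec'] := U _ _ sc'.
move: tl; rewrite in_itv /= EL' -EL => tl.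
exists (a + t); first by rewrite /= in_itv /=; lra.
by rewrite (Ec t) ?(Ec' t) // -EL.
Qed.

End uniqueness_of_lines.

(** * Limits of geodesic lines *)

Section endpoint_convergence.
Context {R : realType} {X : metricType R}.

Lemma cvg_mdistP (I : Type) (F : set_system I) {FF : Filter F} (xs : I -> X) x :
  xs @ F --> x <-> forall e, 0 < e -> F [set i | mdist x (xs i) < e].
Proof. exact: metricType_numDomainType.cvgrPdist_lt. Qed.

Lemma mdist_cvg (I : Type) (F : set_system I) {FF : Filter F} (xs ys : I -> X) x y :
  xs @ F --> x -> ys @ F --> y -> mdist (xs i) (ys i) @[i --> F] --> mdist x y.
Proof.
move=> /cvg_mdistP Hx /cvg_mdistP Hy; apply/cvgrPdist_lt => e e0.
have e2 : 0 < e / 2 by lra.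
apply: filterS (filterI (Hx _ e2) (Hy _ e2)) => i /= [a b].
have := metric_triangle x (xs i) y; have := metric_triangle (xs i) (ys i) y.
have := metric_triangle (xs i) x (ys i); have := metric_triangle x y (ys i).
rewrite (metric_sym (ys i) y) (metric_sym (xs i) x) ltr_norml => *.
by apply/andP; split; lra.
Qed.

Lemma leads_to_lipschitz (c : curves X) z s t : leads_to c z ->
  0 <= s -> 0 <= t -> mdist (c s) (c t) <= `|s - t|.
Proof.
wlog st : s t / s <= t => [H cz s0 t0|].
  have [/H|/ltW/H] := leP s t; first exact.
  by rewrite metric_sym distrC; exact.
case: z => [x [l [[l0 [_ ci]] cx]]|xi /raysE[cr _]] s0 t0; last first.
  by rewrite (ray_isometric cr).
have ci' a b : 0 <= a <= l -> 0 <= b <= l -> mdist (c a) (c b) = `|a - b|.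
  by move=> al bl; apply: ci; rewrite /= in_itv.
have [tl|/ltW lt] := leP t l; first by rewrite ci' //; apply/andP; split; lra.
have [sl|/ltW ls] := leP s l; last by rewrite !cx // mdistxx.
rewrite (cx t) // -(cx l) // ci'; [|apply/andP; split; lra..].
by rewrite distrC (distrC s) !ger0_norm; lra.
Qed.

(** The curves are 1-Lipschitz on [[0, +oo[], so pointwise convergence is uniform on compact sets,
    and the quotient map carries it to [X ∪ ∂X]. *)
Lemma leads_to_cvg (I : Type) (F : set_system I) {FF : Filter F}
    (cs : I -> curves X) (c : curves X) (zs : I -> compactification X) z :
  (forall i, leads_to (cs i) (zs i)) -> leads_to c z ->
  (forall t, 0 <= t -> cs i t @[i --> F] --> c t) -> zs @ F --> z.
Proof.
move=> csz cz csc U; rewrite nbhsE => -[W [oW Wz] WU].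
have [V oV VW] : quotient_open_by (@leads_to R X) W := oW.
have Vc : nbhs c V by apply: open_nbhs_nbhs; split=> //; exact/(VW c z).
have csV : cs @ F --> c.
  apply/fam_cvgP => K [cK K0] P /uniform_nbhs[E [entE EP]].
  move: entE; rewrite -entourage_from_ballE => -[e /= e0 eE].
  have near_c := ((near_covering_withinP K).2 ((compact_near_coveringP K).1 cK))
    I F (fun i y => mdist (c y) (cs i y) < e) FF.
  suff : F [set i | K `<=` [set y | mdist (c y) (cs i y) < e]].
    rewrite -[X in _ -> X]/(F (cs @^-1` P)).
    apply: filterS => i iK; apply: EP => y Ky; apply: eE => /=.
    by rewrite ballEmdist; exact: iK.
  apply: near_c => x Kx; have x0 : 0 <= x.
    by have := K0 _ Kx; rewrite /= in_itv /= andbT.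
  (* Three errors below [e / 4]: moving the parameter along [c], passing from [c] to [cs i] at [x],
     and moving it back along [cs i]. *)
  have e4 : 0 < e / 4 by lra.
  exists (ball x (e / 4), [set i | mdist (c x) (cs i x) < e / 4]).
    split => /=; first exact: nbhsx_ballx.
    by have /cvg_mdistP := csc _ x0; exact.
  move=> [y i] /= [xy ci] Ky; have y0 : 0 <= y.
    by have := K0 _ Ky; rewrite /= in_itv /= andbT.
  have h1 := leads_to_lipschitz cz y0 x0.
  have h2 := leads_to_lipschitz (csz i) x0 y0.
  have := metric_triangle (c y) (c x) (cs i y).
  have := metric_triangle (c x) (cs i x) (cs i y).
  move: xy h1 h2; rewrite /ball /= distrC; lra.
change (F (zs @^-1` U)).
have FV : F (cs @^-1` V) by exact: csV.
apply: filterS FV => i /= Vi; apply: WU; exact/(VW _ _ (csz i)).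
Qed.

Lemma leads_to_cst (x : X) : leads_to (fun=> x) (inner x).
Proof.
exists 0; split => //; split => //; split => // s t; rewrite /= !in_itv /=.
by move=> /le_anti <- /le_anti <-; rewrite mdistxx subrr normr0.
Qed.

Lemma inner_continuous : continuous (@inner R X).
Proof.
move=> x; apply: (@leads_to_cvg _ _ _ (fun y => fun=> y) (fun=> x));
  [exact: leads_to_cst|exact: leads_to_cst|by []].
Qed.

Lemma ideal_continuous : continuous (@ideal R X).
Proof.
apply/continuousP => W oW.
have [V oV VW] : quotient_open_by (@leads_to R X) W := oW.
by exists V => // c xi cx; exact: (VW c (ideal xi)).
Qed.

Hypothesis X_proper : proper_space X.

(** The points [cs i t] eventually lie in the compact ball of radius [1 + |t|] about [x]. Their
    limits along [G] exist for every [t], and distances pass to the limit. *)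
Lemma line_limit (I : Type) (G : set_system I) (GU : UltraFilter G)
    (cs : I -> R -> X) x :
  (forall i, geodesic_line mdist setT (cs i)) -> cs i 0 @[i --> G] --> x ->
  exists c, [/\ geodesic_line mdist setT c, c 0 = x &
    forall t, cs i t @[i --> G] --> c t].
Proof.
move=> csl cs0.
have /choice[c cP] : forall t, exists y : X, cs i t @[i --> G] --> y.
  move=> t; have [|y _ yP] := @ultra_cvg_compact _ G GU X _ (fun i => cs i t)
    (@X_proper x (1 + `|t|)); last by exists y.
  have /cvg_mdistP/(_ 1 ltr01) := cs0; apply: filterS => i /= h.
  apply: le_trans (metric_triangle x (cs i 0) (cs i t)) _.
  by have /lineP -> := csl i; rewrite sub0r normrN lerD2r ltW.
exists c; split => //.
- apply/lineP => s t; have H : mdist (cs i s) (cs i t) @[i --> G] --> mdist (c s) (c t).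
    exact: mdist_cvg.
  have E : (fun i => mdist (cs i s) (cs i t)) = fun=> `|s - t|.
    by apply/funext => i; have /lineP -> := csl i.
  rewrite E in H; exact: cvg_unique_real H (cvg_cst _).
- apply: (cvg_unique _ (cP 0) cs0); exact: metric_hausdorff.
Qed.

Lemma line_limit_eval (I : Type) (G : set_system I) {GF : Filter G}
    (cs : I -> R -> X) (c : R -> X) (ts : I -> R) (t : R) :
  (forall i, geodesic_line mdist setT (cs i)) ->
  (forall t, cs i t @[i --> G] --> c t) -> ts @ G --> t ->
  cs i (ts i) @[i --> G] --> c t.
Proof.
move=> csl csc /cvgrPdist_lt tst; apply/cvg_mdistP => e e0.
have e2 : 0 < e / 2 by lra.
have /cvg_mdistP/(_ _ e2) H := csc t.
apply: filterS (filterI H (tst _ e2)) => i /= [a b].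
have := metric_triangle (c t) (cs i t) (cs i (ts i)).
by have /lineP -> := csl i; lra.
Qed.

(** Stopped at time [ts i], the lines become segments leading to [cs i (ts i)]; as [ts i] grows,
    these converge pointwise to the half-line of [c] ending at [xi]. *)
Lemma line_limit_end (I : Type) (G : set_system I) {GF : Filter G}
    (cs : I -> R -> X) (c : R -> X) xi (ts : I -> R) :
  (forall i, geodesic_line mdist setT (cs i)) ->
  (forall t, cs i t @[i --> G] --> c t) -> pos_end c xi ->
  (forall M, G [set i | M < ts i]) -> inner (cs i (ts i)) @[i --> G] --> ideal xi.
Proof.
move=> csl csc cxi tsy.
(* A nonnegative length is needed for every [i], not only for those charged by [G]. *)
pose u i := Num.max 0 (ts i).
have near_u : G [set i | u i = ts i].
  by apply: filterS (tsy 0) => i /= t0; rewrite /u; apply/max_idPr/ltW.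
suff H : inner (cs i (u i)) @[i --> G] --> ideal xi.
  apply: cvg_trans H; apply: near_eq_cvg.
  by apply: filterS near_u => i /= ->.
apply: (@leads_to_cvg _ _ _ (fun i t => cs i (Num.min t (u i))) c _ (ideal xi)) => //.
- move=> i; have u0 : 0 <= u i by rewrite /u le_max lexx.
  exists (u i); split; last by move=> t /min_idPr ->.
  split => //; split => // s t; rewrite /= !in_itv /= => /andP[_ /min_idPl ->].
  by move=> /andP[_ /min_idPl ->]; have /lineP -> := csl i.
- move=> t t0; apply: cvg_trans (csc t); apply: near_eq_cvg.
  apply: filterS (filterI near_u (tsy t)) => i /= [-> /ltW tt].
  by congr (cs i); apply/esym/min_idPl.
Qed.

End endpoint_convergence.

Lemma near_eq_cvgW (I : Type) (F : set_system I) {FF : Filter F}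
    (T : topologicalType) (f g : I -> T) (l : T) :
  F [set i | f i = g i] -> f @ F --> l -> g @ F --> l.
Proof. by move=> fg fl; apply: cvg_trans fl; exact: near_eq_cvg. Qed.

(** Continuity and injectivity of [h] make limits in [X ∪ ∂X] unique; its values on [∂X] provide the
    circular coordinate. Being a class, these hypotheses are found by inference. *)
Class visual_disk (R : realType) (X : metricType R)
    (h : compactification X -> R * R) : Prop := VisualDisk {
  X_proper : proper_space X;
  X_G1 : G1 X;
  X_G2 : G2 X;
  X_G3 : G3 X;
  chart_continuous : continuous h;
  chart_injective : injective h;
  h_circle : h @` range (@ideal R X) = @unit_circle R }.

Arguments X_proper {R X h _} x r.
Arguments X_G1 {R X h _}.
Arguments X_G2 {R X h _}.
Arguments X_G3 {R X h _}.
Arguments chart_continuous {R X h _} x.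
Arguments chart_injective {R X h _} [x1 x2].
Arguments h_circle {R X h _}.

Definition angle (R : realType) (X : metricType R)
    (h : compactification X -> R * R) (theta : boundary X) (x : X) : R :=
  cw_dist h theta (opposite_end x theta).

(** * Angles of points seen from an ideal point *)

Section angles.
Context {R : realType} {X : metricType R}.
Context {h : compactification X -> R * R} {h_disk : visual_disk h}.
Implicit Types (c g : R -> X) (x y : X) (xi eta theta zeta : boundary X).

Lemma ideal_circle xi : unit_circle (h (ideal xi)).
Proof. by rewrite -h_circle; exists (ideal xi) => //; exists xi. Qed.

Lemma ideal_circle_surj u : unit_circle u -> exists xi, h (ideal xi) = u.
Proof. by rewrite -h_circle => -[_ [xi _ <-] <-]; exists xi. Qed.

Lemma h_ideal_inj xi eta : h (ideal xi) = h (ideal eta) -> xi = eta.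
Proof. by move=> /chart_injective[]. Qed.

Lemma compactification_cvg_unique (I : Type) (F : set_system I)
    {FF : ProperFilter F} (zs : I -> compactification X) (z z' : compactification X) :
  zs @ F --> z -> zs @ F --> z' -> z = z'.
Proof.
move=> zz zz'; apply: chart_injective.
have A : h (zs i) @[i --> F] --> h z by exact: (continuous_cvg _ (chart_continuous z) zz).
have B : h (zs i) @[i --> F] --> h z' by exact: (continuous_cvg _ (chart_continuous z') zz').
by apply: (cvg_unique _ A B); exact: norm_hausdorff.
Qed.

Lemma cw_dist_itv theta zeta : zeta <> theta -> 0 < cw_dist h theta zeta < 2 * pi.
Proof.
move=> ne; have [/andP[_ h2] _] := cw_lengthP (ideal_circle theta) (ideal_circle zeta).
rewrite h2 andbT; apply: cw_length_gt0; try exact: ideal_circle.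
by move=> /h_ideal_inj E; exact: ne.
Qed.

Lemma cw_dist_ge0 theta zeta : 0 <= cw_dist h theta zeta.
Proof.
by have [/andP[] ] := cw_lengthP (ideal_circle theta) (ideal_circle zeta).
Qed.

Lemma cw_distxx theta : cw_dist h theta theta = 0.
Proof. exact/cw_lengthxx/ideal_circle. Qed.

Lemma cw_dist_inj theta : injective (cw_dist h theta).
Proof.
move=> xi eta; rewrite /cw_dist => E.
have [_ e1] := cw_lengthP (ideal_circle theta) (ideal_circle xi).
have [_ e2] := cw_lengthP (ideal_circle theta) (ideal_circle eta).
by apply: h_ideal_inj; rewrite -e1 E e2.
Qed.

Lemma cw_dist_surj theta s : 0 < s < 2 * pi ->
  exists2 zeta, zeta <> theta & cw_dist h theta zeta = s.
Proof.
move=> /andP[s0 s2].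
have [z zE] := ideal_circle_surj (cw_rotation_circle s (ideal_circle theta)).
have E : cw_dist h theta z = s.
  by apply: cw_lengthE => //; [exact: ideal_circle|rewrite ltW].
by exists z => // e; move: s0; rewrite -E e cw_distxx ltxx.
Qed.

Lemma cw_dist_sub theta xi eta : cw_dist h xi eta =
  if cw_dist h theta xi <= cw_dist h theta eta
  then cw_dist h theta eta - cw_dist h theta xi
  else cw_dist h theta eta - cw_dist h theta xi + 2 * pi.
Proof. by apply: cw_length_sub; exact: ideal_circle. Qed.

Lemma angle_itv theta x : 0 < angle h theta x < 2 * pi.
Proof. exact: (cw_dist_itv (@opposite_end_neq _ _ X_G1 X_G3 x theta)). Qed.

Lemma angleE theta c x xi : geodesic_line mdist setT c -> range c x ->
  pos_end c theta -> neg_end c xi -> angle h theta x = cw_dist h theta xi.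
Proof. by move=> cl cx cp cn; rewrite /angle (opposite_endE X_G1 X_G3 cl cx cp cn). Qed.

Lemma angle_opposite_end theta x xi :
  angle h theta x = cw_dist h theta xi -> opposite_end x theta = xi.
Proof. exact: cw_dist_inj. Qed.

Lemma angle_const c theta s t : geodesic_line mdist setT c ->
  pos_end c theta \/ neg_end c theta -> angle h theta (c s) = angle h theta (c t).
Proof. by move=> cl ce; rewrite /angle (opposite_end_const X_G1 X_G3 s t cl ce). Qed.

Lemma angle_inj c theta s t : geodesic_line mdist setT c ->
  ~ pos_end c theta -> ~ neg_end c theta ->
  angle h theta (c s) = angle h theta (c t) -> s = t.
Proof. by move=> cl np nn /cw_dist_inj/(opposite_end_inj X_G1 X_G2 X_G3 cl np nn). Qed.

Lemma angle_surj theta zeta : zeta <> theta ->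
  exists x, angle h theta x = cw_dist h theta zeta.
Proof.
move=> /(line_join_ex X_G2)[c [cl cn cp]]; exists (c 0).
by apply: (angleE cl) => //; exists 0.
Qed.

Lemma transverse_line theta x : exists c,
  [/\ geodesic_line mdist setT c, c 0 = x, ~ pos_end c theta & ~ neg_end c theta].
Proof.
have /andP[a0 a2] := angle_itv theta x.
(* An ideal point at half the angle of [x] is neither [theta] nor the other end of the line from [x]
   to [theta]. *)
have [|z zt zE] := @cw_dist_surj theta (angle h theta x / 2); first lra.
have [c [cl c0 cp]] := line_to X_G1 X_G3 x z.
exists c; split => // [cp'|cn]; first exact: zt (boundary_eq cp cp').
have : angle h theta x = cw_dist h theta z.
  apply: (angleE (line_rev cl)) => //; last exact: neg_end_rev.
  by exists 0 => //; rewrite oppr0.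
by rewrite zE; lra.
Qed.

Lemma pos_end_cvg (I : Type) (F : set_system I) {FF : Filter F}
    (cs : I -> R -> X) (c : R -> X) (xis : I -> boundary X) xi :
  (forall i, pos_end (cs i) (xis i)) -> pos_end c xi ->
  (forall t, cs i t @[i --> F] --> c t) -> ideal (xis i) @[i --> F] --> ideal xi.
Proof.
by move=> csp cp csc; apply: (@leads_to_cvg _ _ _ _ _ cs c _ (ideal xi)).
Qed.

(** Ends of the limit line are limits of the ends, so it is the line through [x] ending at [theta].
    Its two ends differ, which keeps the clockwise length away from its jump. Letting both arguments
    vary serves continuity in either one. *)
Lemma angle_cvg (I : Type) (G : set_system I) (GU : UltraFilter G)
    (ths : I -> boundary X) theta (xs : I -> X) x :
  ideal (ths i) @[i --> G] --> ideal theta -> xs @ G --> x ->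
  angle h (ths i) (xs i) @[i --> G] --> angle h theta x.
Proof.
move=> tht xsx.
have /choice[cs csP] : forall i, exists c, [/\ geodesic_line mdist setT c, c 0 = xs i,
    pos_end c (ths i) & neg_end c (opposite_end (xs i) (ths i))].
  by move=> i; exact: (line_to_opposite X_G1 X_G3).
have csl i : geodesic_line mdist setT (cs i) by have [] := csP i.
have [|c [cl c0 csc]] := @line_limit _ _ X_proper _ _ GU cs x csl.
  by under eq_fun do rewrite (let: And4 _ e _ _ := csP _ in e).
have [th' cp] := pos_end_ex cl; have [z cn] := neg_end_ex cl.
have E : th' = theta.
  have : ideal (ths i) @[i --> G] --> ideal th'.
    by apply: (pos_end_cvg _ cp csc) => i; have [] := csP i.
  by move=> /(compactification_cvg_unique tht)[].
subst th'; rewrite {2}/angle (opposite_endE X_G1 X_G3 cl _ cp cn); last by exists 0.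
have ozs : ideal (opposite_end (xs i) (ths i)) @[i --> G] --> ideal z.
  apply: (@pos_end_cvg _ _ _ (fun i t => cs i (- t)) (fun t => c (- t))) => //.
  by move=> i; have [] := csP i.
apply: cw_length_cvg; try by move=> *; exact: ideal_circle.
- by move=> /h_ideal_inj E; exact: (line_ends_neq cl cp cn).
- exact: (continuous_cvg _ (chart_continuous _) tht).
- exact: (continuous_cvg _ (chart_continuous _) ozs).
Qed.

Lemma angle_continuous theta : continuous (angle h theta).
Proof.
move=> x; apply: cvg_ultra => G GU xG.
by apply: (@angle_cvg _ _ GU (fun=> theta) theta id); [exact: cvg_cst|].
Qed.

Lemma angle_continuous_end x : continuous (fun theta => angle h theta x).
Proof.
move=> theta; apply: (@cvg_ultra _ (nbhs theta) (nbhs_filter theta)) => G GU tG.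
apply: (@angle_cvg _ _ GU id theta (fun=> x)); last exact: cvg_cst.
by apply: cvg_trans (@ideal_continuous _ _ theta) => A /tG.
Qed.

Lemma line_continuous c : geodesic_line mdist setT c -> continuous c.
Proof.
move=> /lineP cl t; apply/cvg_mdistP => e e0.
by apply: filterS (nbhsx_ballx t e e0) => s /=; rewrite /ball /= cl.
Qed.

Lemma angle_line_continuous theta c : geodesic_line mdist setT c ->
  continuous (fun t => angle h theta (c t)).
Proof.
move=> cl t; apply: (@continuous_comp _ _ _ c (angle h theta)).
  exact: line_continuous.
exact: angle_continuous.
Qed.

(** Lines from [x] through [xs i] have a limit line. If the distances converge, so do the points, to
    a limit that must be [x]; if the distances go to infinity, the points tend to an ideal point,
    which is excluded. *)
Lemma inner_cvg_inv (I : Type) (G : set_system I) (GU : UltraFilter G)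
    (xs : I -> X) x : inner (xs i) @[i --> G] --> inner x -> xs @ G --> x.
Proof.
move=> xsx; have [theta _] : exists theta : boundary X, True.
  have [|th _] := @ideal_circle_surj (1, 0); last by exists th.
  by rewrite /unit_circle /=; ring.
have /choice[cs csP] : forall i, exists c, [/\ geodesic_line mdist setT c, c 0 = x &
    c (mdist x (xs i)) = xs i].
  by move=> i; exact: (line_through X_G1 X_G3 _ _ theta).
have csl i : geodesic_line mdist setT (cs i) by have [] := csP i.
have csE i : cs i (mdist x (xs i)) = xs i by have [] := csP i.
have [|c [cl c0 csc]] := @line_limit _ _ X_proper _ _ GU cs x csl.
  under eq_fun do rewrite (let: And3 _ e _ := csP _ in e); exact: cvg_cst.
have [[l dl]|dy|dn] := @ultra_real_cvg _ G GU _ (fun i => mdist x (xs i)).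
- have xsl : xs @ G --> c l.
    have : cs i (mdist x (xs i)) @[i --> G] --> c l by exact: line_limit_eval.
    by apply: near_eq_cvgW; apply: filterE => i /=; rewrite csE.
  suff <- : c l = x by [].
  have /(compactification_cvg_unique xsx)[->//] : inner (xs i) @[i --> G] --> inner (c l).
  exact: (continuous_cvg _ (@inner_continuous _ _ (c l)) xsl).
- have [z cp] := pos_end_ex cl.
  have : inner (xs i) @[i --> G] --> ideal z.
    have : inner (cs i (mdist x (xs i))) @[i --> G] --> ideal z.
      exact: line_limit_end csl csc cp dy.
    by apply: near_eq_cvgW; apply: filterE => i /=; rewrite csE.
  by move=> /(compactification_cvg_unique xsx).
- have /filter_ex[i /=] := dn 0.
  by rewrite ltNge mdist_ge0.
Qed.

End angles.

(** * Continuity of the angle up to the ideal boundary *)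

Lemma connectedU1_closure (T : topologicalType) (A : set T) (p : T) :
  connected A -> closure A p -> connected (A `|` [set p]).
Proof.
move=> cA clp U U0 [V oV UV] [C cC UC].
have [[a [Ua Aa]]|nUA] := pselect (U `&` A !=set0).
  have UAE : U `&` A = A.
    apply: cA; first by exists a.
      by exists V => //; rewrite UV setIAC; congr (_ `&` _); rewrite setUK.
    by exists C => //; rewrite UC setIAC; congr (_ `&` _); rewrite setUK.
  have AC : A `<=` C by rewrite -UAE UC => x [[]].
  rewrite UC; apply/setIidPl => x [/AC//|->].
  by have := closureS AC clp; rewrite -(closure_id C).1.
have [u Uu] := U0.
have Up : U p.
  have : ((A `|` [set p]) `&` V) u by rewrite -UV.
  by move=> [[Au|/= <-//] _]; case: nUA; exists u.
have Vp : V p by have := Up; rewrite UV => -[].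
have [a [Aa Va]] := clp V (open_nbhs_nbhs (conj oV Vp)).
by case: nUA; exists a; split => //; rewrite UV; split => //; left.
Qed.

Section angle_at_infinity.
Context {R : realType} {X : metricType R}.
Context {h : compactification X -> R * R} {h_disk : visual_disk h}.
Implicit Types (c g : R -> X) (x y : X) (xi eta theta zeta : boundary X).

(* If the limit v of the angles differs from that of zeta, the line joining to
   theta an end xi at an angle strictly between the two crosses all segments
   [y, x_i] issued from a point y of (zeta, theta).  The crossing points leave
   every bounded set, so they tend both to zeta and to one of xi, theta. *)
Lemma angle_cvg_ideal (I : Type) (G : set_system I) (GU : UltraFilter G)
    (xs : I -> X) theta zeta : zeta <> theta ->
  inner (xs i) @[i --> G] --> ideal zeta ->
  angle h theta (xs i) @[i --> G] --> cw_dist h theta zeta.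
Proof.
move=> zt xsz; pose a := cw_dist h theta zeta.
have /andP[a0 a2] : 0 < a < 2 * pi by exact: cw_dist_itv.
have [|v] := @ultra_cvg_compact _ G GU R `[0, 2 * pi]%classic
    (fun i => angle h theta (xs i)) (@segment_compact _ _ _).
  apply: filterE => i /=; rewrite in_itv /=.
  by have /andP[/ltW -> /ltW ->] : 0 < angle h theta (xs i) < 2 * pi by exact: angle_itv.
rewrite /= in_itv /= => /andP[v0 v2] xsv.
have [E|/eqP va] := eqVneq v a; first by rewrite -/a -E.
exfalso.
pose m := (v + a) / 2.
have [|xi xit xim] := @cw_dist_surj _ _ h _ theta m.
  by rewrite /m; apply/andP; split; lra.
have [c0 [c0l c0n c0p]] := line_join_ex X_G2 zt.
pose y := c0 0.
have ya : angle h theta y = a by apply: (angleE c0l) => //; exists 0.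
have /choice[cs csP] : forall i, exists c, [/\ geodesic_line mdist setT c, c 0 = y &
    c (mdist y (xs i)) = xs i].
  by move=> i; exact: (line_through X_G1 X_G3 _ _ theta).
have csl i : geodesic_line mdist setT (cs i) by have [] := csP i.
have cs0 i : cs i 0 = y by have [] := csP i.
have csE i : cs i (mdist y (xs i)) = xs i by have [] := csP i.
have [|c [cl c_0 csc]] := @line_limit _ _ X_proper _ _ GU cs y csl.
  by under eq_fun do rewrite cs0; exact: cvg_cst.
have dy M : G [set i | M < mdist y (xs i)].
  have [[l dl]|//|dn] := @ultra_real_cvg _ G GU _ (fun i => mdist y (xs i)).
    have xsl : xs @ G --> c l.
      have : cs i (mdist y (xs i)) @[i --> G] --> c l by exact: line_limit_eval.
      by apply: near_eq_cvgW; apply: filterE => i /=; rewrite csE.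
    have : inner (xs i) @[i --> G] --> inner (c l).
      exact: (continuous_cvg _ (@inner_continuous _ _ (c l)) xsl).
    by move=> /(compactification_cvg_unique xsz).
  by have /filter_ex[i /=] := dn 0; rewrite ltNge mdist_ge0.
have cp : pos_end c zeta.
  have [z cz] := pos_end_ex cl.
  have : inner (xs i) @[i --> G] --> ideal z.
    have : inner (cs i (mdist y (xs i))) @[i --> G] --> ideal z.
      exact: line_limit_end csl csc cz dy.
    by apply: near_eq_cvgW; apply: filterE => i /=; rewrite csE.
  by move=> /(compactification_cvg_unique xsz)[->].
have cE : c = fun t => c0 (- t).
  apply: (line_to_uniq X_G1 X_G3 cl (line_rev c0l) _ cp c0n).
  by rewrite oppr0.
have ca t : angle h theta (c t) = a.
  rewrite -ya -c_0; apply: angle_const => //; right.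
  by rewrite cE; exact: neg_end_rev.
have near_m : G [set i | Num.min a (angle h theta (xs i)) <= m <=
                         Num.max a (angle h theta (xs i))].
  have [va'|va'|//] := ltgtP v a.
    have vm : v < m by rewrite /m; lra.
    apply: filterS (cvgr_lt _ xsv _ vm) => i /= /ltW im.
    by rewrite ge_min im orbT le_max /m; apply/orP; left; lra.
  have vm : m < v by rewrite /m; lra.
  apply: filterS (cvgr_gt _ xsv _ vm) => i /= /ltW im.
  by rewrite le_max im orbT andbT ge_min /m; apply/orP; left; lra.
have /choice[ts tsP] : forall i, exists t, Num.min a (angle h theta (xs i)) <= m <=
    Num.max a (angle h theta (xs i)) ->
    0 <= t /\ angle h theta (cs i t) = m.
  move=> i; have [mi|mi] := pselect (Num.min a (angle h theta (xs i)) <= m <=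
      Num.max a (angle h theta (xs i))); last by exists 0 => /mi.
  have [||t /itvP tI tm] := @IVT R (fun t => angle h theta (cs i t)) 0
      (mdist y (xs i)) m (mdist_ge0 _ _).
  - by apply: continuous_subspaceT; exact: angle_line_continuous.
  - by rewrite cs0 csE ya.
  by exists t => _; rewrite tI.
have {}tsP : G [set i | 0 <= ts i /\ angle h theta (cs i (ts i)) = m].
  by apply: filterS near_m => i /tsP.
(* If [ts] had a finite limit [t], the crossing points would tend to [c t], whose angle would be
   both [a] and [m]. *)
have tsy M : G [set i | M < ts i].
  have [[t tst]|//|tsn] := @ultra_real_cvg _ G GU _ ts; last first.
    have [i [/= + [+ _]]] := filter_ex (filterI (tsn 0) tsP).
    by rewrite ltNge => /negP.
  have qc : cs i (ts i) @[i --> G] --> c t by exact: line_limit_eval.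
  have : angle h theta (cs i (ts i)) @[i --> G] --> a.
    rewrite -(ca t).
    apply: (continuous_cvg _ (@angle_continuous _ _ h _ theta (c t)) qc).
  have am : angle h theta (cs i (ts i)) @[i --> G] --> m.
    apply: (@near_eq_cvgW _ _ _ _ (fun=> m)); last exact: cvg_cst.
    by apply: filterS tsP => i [].
  by move=> /(cvg_unique_real am); rewrite /m => E; exfalso; apply: va; lra.
have qz : inner (cs i (ts i)) @[i --> G] --> ideal zeta.
  exact: line_limit_end csl csc cp tsy.
have [g [gl gn gp]] := line_join_ex X_G2 xit.
have /choice[us usP] : forall i, exists u, angle h theta (cs i (ts i)) = m ->
    g u = cs i (ts i).
  move=> i; have [E|nE] := pselect (angle h theta (cs i (ts i)) = m); last by exists 0.
  have [|u _ gu] := @opposite_end_range _ _ X_G1 X_G2 X_G3 g (cs i (ts i)) theta xi gl gp gn.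
    by apply: (@angle_opposite_end _ _ h); rewrite xim.
  by exists u.
have gz : inner (g (us i)) @[i --> G] --> ideal zeta.
  move: qz; apply: near_eq_cvgW; apply: filterS tsP => i /= [_ /usP ->] //.
have [[u usu]|usy|usn] := @ultra_real_cvg _ G GU _ us.
- have : inner (g (us i)) @[i --> G] --> inner (g u).
    apply: (continuous_cvg _ (@inner_continuous _ _ (g u))).
    exact: (continuous_cvg _ (@line_continuous _ _ g gl u) usu).
  by move=> /(compactification_cvg_unique gz).
- have : inner (g (us i)) @[i --> G] --> ideal theta.
    apply: (@line_limit_end _ _ _ _ _ (fun=> g) g) => // t; exact: cvg_cst.
  by move=> /(compactification_cvg_unique gz)[].
- have : inner (g (us i)) @[i --> G] --> ideal xi.
    have gl' := line_rev gl.
    have := @line_limit_end _ _ _ _ _ (fun=> (fun t => g (- t))) (fun t => g (- t)) xi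
      (fun i => - us i) (fun=> gl') (fun=> cvg_cst _) gn.
    under eq_fun do rewrite opprK.
    by apply => M; apply: filterS (usn (- M)) => i /=; rewrite ltrNr.
  move=> /(compactification_cvg_unique gz)[E]; apply: va.
  by move: xim; rewrite -E -/a /m; lra.
Qed.

(** The value 0 at [ideal theta] is only a placeholder: the lines ending at [theta] carry every
    angle there, so no limit exists. *)
Definition end_angle theta (z : compactification X) : R :=
  match z with inner x => angle h theta x | ideal zeta => cw_dist h theta zeta end.

(** An ultrafilter charges either the inner or the ideal points, which leaves one case for each kind
    of point and each kind of limit. *)
Lemma end_angle_continuous theta z : z <> ideal theta ->
  {for z, continuous (end_angle theta)}.
Proof.
move=> zt; apply: (@cvg_ultra _ (nbhs z) (nbhs_filter z)) => G GU zG.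
have Gz : id @ G --> z by exact: zG.
have [Gi|Gi] := in_ultra_setVsetC (range (@inner R X)) GU.
  have [_ [x0 _ _]] := filter_ex Gi.
  (* The default [x0] is taken only at ideal points, a set not charged by [G]. *)
  pose xs z' := if z' is inner x then x else x0.
  have xsE : G [set z' | inner (xs z') = z'] by apply: filterS Gi => _ [x _ <-].
  have xsz : inner (xs i) @[i --> G] --> z.
    by move: Gz; apply: near_eq_cvgW; apply: filterS xsE.
  suff : angle h theta (xs i) @[i --> G] --> end_angle theta z.
    by apply: near_eq_cvgW; apply: filterS Gi => _ [x _ <-].
  case: z {zG Gz} zt xsz => [x|zeta] /= zt xsz.
    have xsx : xs @ G --> x by exact: inner_cvg_inv.
    by apply: angle_cvg => //; exact: cvg_cst.
  by apply: angle_cvg_ideal => // E; apply: zt; rewrite E.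
have {}Gi : G (range (@ideal R X)).
  by apply: filterS Gi => -[x|xi] ni; [case: ni; exists x|exists xi].
pose zs z' := if z' is ideal xi then xi else theta.
have zsE : G [set z' | ideal (zs z') = z'] by apply: filterS Gi => _ [x _ <-].
have zsz : ideal (zs i) @[i --> G] --> z.
  by move: Gz; apply: near_eq_cvgW; apply: filterS zsE.
suff : cw_dist h theta (zs i) @[i --> G] --> end_angle theta z.
  by apply: near_eq_cvgW; apply: filterS Gi => _ [x _ <-].
have hzs : h (ideal (zs i)) @[i --> G] --> h z.
  exact: (continuous_cvg _ (chart_continuous z) zsz).
case: z {zG Gz} zt zsz hzs => [x|zeta] /= zt zsz hzs; last first.
  apply: cw_length_cvg => //; try by move=> *; exact: ideal_circle.
    by move=> /chart_injective E; exact: zt.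
  exact: cvg_cst.
(* Ideal points do not tend to inner ones: the circle is closed, and [h] is injective with [∂X]
   mapped onto it. *)
exfalso; have : unit_circle (h (inner x)).
  have c1 : (h (ideal (zs i))).1 @[i --> G] --> (h (inner x)).1.
    by apply: (cvg_comp _ fst hzs); exact: cvg_fst.
  have c2 : (h (ideal (zs i))).2 @[i --> G] --> (h (inner x)).2.
    by apply: (cvg_comp _ snd hzs); exact: cvg_snd.
  have c3 : (h (ideal (zs i))).1 ^+ 2 + (h (ideal (zs i))).2 ^+ 2 @[i --> G] -->
      (h (inner x)).1 ^+ 2 + (h (inner x)).2 ^+ 2.
    exact: (cvgD (cvgM c1 c1) (cvgM c2 c2)).
  apply: (cvg_unique_real c3).
  apply: (@near_eq_cvgW _ _ _ _ (fun=> 1 : R)); last exact: cvg_cst.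
  by apply: filterE => i /=; apply/esym; exact: ideal_circle.
by move=> /ideal_circle_surj[xi /chart_injective].
Qed.

End angle_at_infinity.

(** * Regions bounded by two lines with a common end *)

Section regions.
Context {R : realType} {X : metricType R}.
Context {h : compactification X -> R * R} {h_disk : visual_disk h}.
Implicit Types (c g : R -> X) (x y : X) (xi eta theta zeta : boundary X).

Lemma cw_dist_lt2pi theta zeta : cw_dist h theta zeta < 2 * pi.
Proof.
by have [/andP[] ] := cw_lengthP (ideal_circle (h := h) theta) (ideal_circle zeta).
Qed.

Lemma cw_arcP theta xi eta : xi <> theta -> eta <> theta ->
  cw_arc h xi eta theta <-> cw_dist h theta eta < cw_dist h theta xi.
Proof.
move=> xt et; rewrite /cw_arc /= (cw_dist_sub theta xi theta).
rewrite (cw_dist_sub theta xi eta) cw_distxx.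
have /andP[a0 a2] : 0 < cw_dist h theta xi < 2 * pi by exact: cw_dist_itv.
have /andP[b0 b2] : 0 < cw_dist h theta eta < 2 * pi by exact: cw_dist_itv.
rewrite (leNgt _ 0) a0 /=.
by case: (leP (cw_dist h theta xi) (cw_dist h theta eta)) => ab; split => //; lra.
Qed.

(** Cutting the circle at [theta] turns arcs avoiding [theta] into intervals of the coordinate,
    whatever the order of their ends. *)
Lemma arc_avoidingP theta xi eta zeta : xi <> theta -> eta <> theta ->
  arc_avoiding h theta xi eta zeta <->
  Num.min (cw_dist h theta xi) (cw_dist h theta eta) <= cw_dist h theta zeta <=
  Num.max (cw_dist h theta xi) (cw_dist h theta eta).
Proof.
move=> xt et; rewrite /arc_avoiding; have E := cw_arcP xt et.
have /andP[a0 a2] : 0 < cw_dist h theta xi < 2 * pi by exact: cw_dist_itv.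
have /andP[b0 b2] : 0 < cw_dist h theta eta < 2 * pi by exact: cw_dist_itv.
have z0 : 0 <= cw_dist h theta zeta by exact: cw_dist_ge0.
have z2 := cw_dist_lt2pi theta zeta.
case: asboolP => [/E ba|nE].
  rewrite /cw_arc /= (cw_dist_sub theta eta zeta) (cw_dist_sub theta eta xi).
  rewrite (ltW ba) (min_idPr (ltW ba)) (max_idPl (ltW ba)).
  clear E xt et; case: (leP (cw_dist h theta eta) (cw_dist h theta zeta)) => bz;
    split => [?|/andP[? ?]]; try (apply/andP; split); lra.
have ab : cw_dist h theta xi <= cw_dist h theta eta.
  by rewrite leNgt; apply/negP => /E.
rewrite /cw_arc /= (cw_dist_sub theta xi zeta) (cw_dist_sub theta xi eta).
rewrite ab (min_idPl ab) (max_idPr ab).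
clear E nE xt et; case: (leP (cw_dist h theta xi) (cw_dist h theta zeta)) => bz;
  split => [?|/andP[? ?]]; try (apply/andP; split); lra.
Qed.

Lemma arc_lengthE theta xi eta : xi <> theta -> eta <> theta ->
  arc_length h theta xi eta = `|cw_dist h theta xi - cw_dist h theta eta|.
Proof.
move=> xt et; rewrite /arc_length; have E := cw_arcP xt et.
case: asboolP => [/E ba|nE].
  by rewrite (cw_dist_sub theta eta xi) (ltW ba) gtr0_norm // subr_gt0.
have ab : cw_dist h theta xi <= cw_dist h theta eta.
  by rewrite leNgt; apply/negP => /E.
by rewrite (cw_dist_sub theta xi eta) ab distrC ger0_norm // subr_ge0.
Qed.

Lemma line_betweenP theta xi x : xi <> theta ->
  line_between theta xi x <-> angle h theta x = cw_dist h theta xi.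
Proof.
move=> xt; split => [[c [cl cn cp] [t _ ct]]|E].
  apply: (angleE (line_rev cl)) => //; last exact: neg_end_rev.
  by exists (- t) => //; rewrite opprK.
have [c [cl cn cp]] := line_join_ex X_G2 xt.
have [t _ ct] := opposite_end_range X_G1 X_G2 X_G3 cl cp cn (angle_opposite_end E).
exists (fun t => c (- t)); last by exists (- t) => //; rewrite opprK.
split => //; [exact: line_rev|exact: neg_end_rev].
Qed.

(* The angle extends continuously to the ideal points other than theta, hence
   takes on a connected set missing both lines only values on one side of
   each of the two lines. *)
Lemma regionE theta xi eta : xi <> theta -> eta <> theta ->
  region h theta xi eta = [set x |
    Num.min (cw_dist h theta xi) (cw_dist h theta eta) < angle h theta x <
    Num.max (cw_dist h theta xi) (cw_dist h theta eta)].
Proof.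
move=> xt et; set lo := Num.min _ _; set hi := Num.max _ _.
apply/seteqP; split => x /=.
  move=> [zeta [/(arc_avoidingP _ xt et) zarc zx ze [B [Bz Bl Bc] Bx]]].
  have Bt z : B z -> z <> ideal theta.
    by move=> /Bl nl E; apply: nl; right; exists theta; [left; left|].
  have hit z xi' : xi' = xi \/ xi' = eta -> B z ->
      end_angle (h := h) theta z = cw_dist h theta xi' -> False.
    move=> xi'E Bz' E; apply: (Bl _ Bz').
    have xi't : xi' <> theta by case: xi'E => ->.
    case: z Bz' E => [y|z] Bz' /= E.
      left; exists y => //; move/(line_betweenP _ xi't): E => E.
      by case: xi'E => e; [left|right]; rewrite -e.
    right; exists z => //; move/cw_dist_inj: E => ->.
    by case: xi'E => ->; [left; right|right].
  have Bi : is_interval (end_angle (h := h) theta @` B).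
    apply/connected_intervalP/connected_continuous_connected => //.
    by apply: continuous_in_subspaceT => z /set_mem/Bt; exact: end_angle_continuous.
  have vB v : (exists2 xi', xi' = xi \/ xi' = eta & v = cw_dist h theta xi') ->
      ~ (end_angle (h := h) theta @` B) v.
    by move=> [xi' xi'E ->] [z Bz' E]; exact: (hit z xi').
  have loB : ~ (end_angle (h := h) theta @` B) lo.
    by apply: vB; rewrite /lo /Num.min; case: ifP; [exists xi|exists eta]; auto.
  have hiB : ~ (end_angle (h := h) theta @` B) hi.
    by apply: vB; rewrite /hi /Num.max; case: ifP; [exists eta|exists xi]; auto.
  have Vz : (end_angle (h := h) theta @` B) (cw_dist h theta zeta) by exists (ideal zeta).
  have Vx : (end_angle (h := h) theta @` B) (angle h theta x) by exists (inner x).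
  apply/andP; split; rewrite ltNge; apply/negP => le.
    by apply: loB; apply: (Bi _ _ Vx Vz); rewrite le; case/andP: zarc.
  by apply: hiB; apply: (Bi _ _ Vz Vx); rewrite le andbT; case/andP: zarc.
move=> /andP[lox hix]; have [c [cl c0 cp cn]] := line_to_opposite X_G1 X_G3 x theta.
set zeta := opposite_end x theta in cn.
have angE : angle h theta x = cw_dist h theta zeta by [].
have zx : zeta <> xi.
  by move=> E; move: lox hix; rewrite angE E /lo /hi gt_min lt_max ltxx /= => a b;
     have := lt_trans a b; rewrite ltxx.
have ze : zeta <> eta.
  by move=> E; move: lox hix; rewrite angE E /lo /hi gt_min lt_max ltxx /= !orbF => a b;
     have := lt_trans a b; rewrite ltxx.
exists zeta; split => //.
  by apply/(arc_avoidingP _ xt et); rewrite -angE !ltW.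
have gl := line_rev cl.
(* The connected set joining [x] to [zeta] is the line through [x] ending at [theta], on which the
   angle is constant, with its end [zeta] added. *)
pose A := (fun t => inner (c (- t))) @` [set: R].
exists (A `|` [set ideal zeta]); last first.
  by left; exists 0 => //; rewrite oppr0 c0.
split; first by right.
  have angc t : angle h theta (c t) = cw_dist h theta zeta.
    by apply: (angleE cl) => //; exists t.
  move=> _ [[t _ <-]|->].
    move=> [[y [ly|ly] [E]]|[z _]] //; rewrite E in ly.
      by move/(line_betweenP _ xt): ly; rewrite angc => /cw_dist_inj.
    by move/(line_betweenP _ et): ly; rewrite angc => /cw_dist_inj.
  move=> [[y _]|[z + [E]]] //; rewrite {}E => -[[E|E]|E] //.
  exact: (opposite_end_neq X_G1 X_G3 E).
apply: connectedU1_closure.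
  apply: connected_continuous_connected; first by apply/connected_intervalP.
  apply: continuous_subspaceT => t.
  apply: (@continuous_comp _ _ _ (fun t => c (- t)) (@inner R X)).
    exact: (line_continuous gl).
  exact: inner_continuous.
move=> U Uz.
have : inner (c (- t)) @[t --> +oo] --> ideal zeta.
  apply: (@line_limit_end _ _ _ _ _ (fun=> (fun t => c (- t))) (fun t => c (- t))) => //.
    by move=> t; exact: cvg_cst.
  by move=> M; exists M; split; [exact: num_real|].
move=> /(_ _ Uz) H.
have [t Ut] : exists t, U (inner (c (- t))) by exact: (@filter_ex _ +oo).
exists (inner (c (- t))); split => //.
by exists t.
Qed.

Lemma angle_line_mono theta c : geodesic_line mdist setT c ->
  ~ pos_end c theta -> ~ neg_end c theta ->
  (forall s t, s < t -> angle h theta (c s) < angle h theta (c t)) \/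
  (forall s t, s < t -> angle h theta (c t) < angle h theta (c s)).
Proof.
move=> cl np nn.
have [||H|H] := @itv_continuous_inj_mono R (fun t => angle h theta (c t)) `]-oo, +oo[.
- by apply: continuous_subspaceT; exact: angle_line_continuous.
- by move=> s t _ _; exact: angle_inj.
- by left => s t; exact: H.
- by right => s t; exact: H.
Qed.

End regions.

(** The sides of the polygon enter later, when lines are shown to have infinite [d]-length. *)
Class convex_domain (R : realType) (X : metricType R) (P : set X) : Prop :=
  ConvexDomain {
    domain_nonempty : P !=set0;
    domain_open : open P;
    domain_bounded : bounded_subset P;
    domain_convex : convex_set P }.

(** * Supporting lines of a convex domain *)

Section support_lines.
Context {R : realType} {X : metricType R}.
Context {h : compactification X -> R * R} {h_disk : visual_disk h}.
Context {P : set X} {P_domain : convex_domain P}.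
Implicit Types (c g : R -> X) (x y : X) (xi eta theta zeta : boundary X).

Definition angle_inf theta : R := inf (angle h theta @` P).
Definition angle_sup theta : R := sup (angle h theta @` P).

Lemma line_near c t : geodesic_line mdist setT c -> P (c t) ->
  exists2 e, 0 < e & forall s, `|t - s| < e -> P (c s).
Proof.
move=> cl Pct; have := line_continuous cl.
move=> /(_ t _ (open_nbhs_nbhs (conj domain_open Pct)))/nbhs_ballP[e /= e0 H].
by exists e => // s /H.
Qed.

Lemma line_convex c r s t : geodesic_line mdist setT c -> P (c r) -> P (c t) ->
  r <= s <= t -> P (c s).
Proof.
by move=> cl Pr Pt rst; apply: (domain_convex Pr Pt); exact: segment_line.
Qed.

(** A short piece of a line through [x] not ending at [theta] stays in the open set [P], and the
    angle is strictly monotone on it. *)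
Lemma angle_not_extremal theta x : P x -> exists p q, [/\ P p, P q,
  angle h theta p < angle h theta x & angle h theta x < angle h theta q].
Proof.
move=> Px; have [c [cl c0 np nn]] := transverse_line (h_disk := h_disk) theta x.
have Pc0 : P (c 0) by rewrite c0.
have [e e0 He] := line_near cl Pc0.
have P1 : P (c (e / 2)) by apply: He; rewrite sub0r normrN ger0_norm; lra.
have P2 : P (c (- (e / 2))) by apply: He; rewrite sub0r opprK ger0_norm; lra.
rewrite -c0; have [H|H] := angle_line_mono (h_disk := h_disk) cl np nn.
  by exists (c (- (e / 2))), (c (e / 2)); split => //; apply: H; lra.
by exists (c (e / 2)), (c (- (e / 2))); split => //; apply: H; lra.
Qed.

Lemma angle_has_sup theta : has_sup (angle h theta @` P).
Proof.
split; first by have [x Px] := domain_nonempty; exists (angle h theta x), x.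
by exists (2 * pi) => _ [x _ <-]; have /andP[_ /ltW] := angle_itv (h_disk := h_disk) theta x.
Qed.

Lemma angle_has_inf theta : has_inf (angle h theta @` P).
Proof.
split; first by have [x Px] := domain_nonempty; exists (angle h theta x), x.
by exists 0 => _ [x _ <-]; have /andP[/ltW] := angle_itv (h_disk := h_disk) theta x.
Qed.

Lemma angle_domain_itv theta x : P x ->
  angle_inf theta < angle h theta x < angle_sup theta.
Proof.
move=> /(angle_not_extremal theta)[p [q [Pp Pq px xq]]]; apply/andP; split.
  apply: le_lt_trans px; apply: ge_inf; first exact: (angle_has_inf theta).2.
  by exists p.
apply: (lt_le_trans xq); apply: sup_upper_bound; first exact: angle_has_sup.
by exists q.
Qed.

Lemma angle_inf_lt_sup theta : angle_inf theta < angle_sup theta.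
Proof.
have [x Px] := domain_nonempty; have /andP[a b] := angle_domain_itv theta Px.
exact: lt_trans a b.
Qed.

(** [P] lies in a compact ball, where the angle attains extrema inside []0, 2 * pi[]. This keeps the
    ends of the supporting lines away from [theta]. *)
Lemma angle_extrema_itv theta : 0 < angle_inf theta /\ angle_sup theta < 2 * pi.
Proof.
have [x Px] := domain_nonempty; have [x0 [r Pr]] := domain_bounded.
have K0 : [set y | mdist x0 y <= r] !=set0 by exists x; exact: Pr.
have cts : {within [set y | mdist x0 y <= r], continuous (angle h theta)}.
  by apply: continuous_subspaceT; exact: angle_continuous.
have [p _ Hp] := compact_EVT_min K0 (X_proper x0 r) cts.
have [q _ Hq] := compact_EVT_max K0 (X_proper x0 r) cts.
have A0 : angle h theta @` P !=set0 by exists (angle h theta x), x.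
split.
  apply: (@lt_le_trans _ _ (angle h theta p)).
    by have /andP[] := angle_itv (h_disk := h_disk) theta p.
  apply: lb_le_inf => // _ [y Py <-]; apply: Hp; apply/mem_set; exact: Pr.
apply: (@le_lt_trans _ _ (angle h theta q)).
  apply: ge_sup => // _ [y Py <-]; apply: Hq; apply/mem_set; exact: Pr.
by have /andP[] := angle_itv (h_disk := h_disk) theta q.
Qed.

Lemma angle_domain_surj theta v : angle_inf theta < v < angle_sup theta ->
  exists2 x, P x & angle h theta x = v.
Proof.
move=> /andP[lv vh].
have [|_ [x Px <-] xv] := @inf_adherent _ _ (v - angle_inf theta) _ (angle_has_inf theta).
  by rewrite subr_gt0.
have [|_ [y Py <-] vy] := @sup_adherent _ _ (angle_sup theta - v) _ (angle_has_sup theta).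
  by rewrite subr_gt0.
have {}xv : angle h theta x < v by move: xv; rewrite /angle_inf; lra.
have {}vy : v < angle h theta y by move: vy; rewrite /angle_sup; lra.
have [c [cl c0 cy]] := line_through X_G1 X_G3 x y theta.
have [||t /itvP tI tv] := @IVT R (fun t => angle h theta (c t)) 0 (mdist x y) v
    (mdist_ge0 _ _).
- by apply: continuous_subspaceT; exact: angle_line_continuous.
- by rewrite c0 cy ge_min le_max (ltW xv) (ltW vy) orbT.
exists (c t) => //; apply: (@line_convex c 0 t (mdist x y)); rewrite ?c0 ?cy //.
by rewrite !tI.
Qed.

Lemma domain_sub_region theta xi eta : xi <> theta -> eta <> theta ->
  P `<=` region h theta xi eta <->
  Num.min (cw_dist h theta xi) (cw_dist h theta eta) <= angle_inf theta /\
  angle_sup theta <= Num.max (cw_dist h theta xi) (cw_dist h theta eta).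
Proof.
move=> xt et; rewrite regionE //; split => [H|[lo hi] x Px /=].
  have [x Px] := domain_nonempty.
  have A0 : angle h theta @` P !=set0 by exists (angle h theta x), x.
  split; first by apply: lb_le_inf => // _ [y /H/andP[/ltW + _] <-].
  by apply: ge_sup => // _ [y /H/andP[_ /ltW] + <-].
have /andP[a b] := angle_domain_itv theta Px.
by rewrite (le_lt_trans lo a) (lt_le_trans b hi).
Qed.

(** Regions containing [P] correspond to intervals containing []angle_inf, angle_sup[], so the
    minimal one has these two ends. Clockwise order tells which is [xi]. *)
Lemma support_endsE theta : exists xi eta, [/\ xi <> theta, eta <> theta,
  support_ends h P theta = (xi, eta), cw_dist h theta xi = angle_sup theta &
  cw_dist h theta eta = angle_inf theta].
Proof.
have [l0 s2] := angle_extrema_itv theta; have ls := angle_inf_lt_sup theta.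
have [|xi xt xE] := @cw_dist_surj _ _ h _ theta (angle_sup theta).
  by rewrite s2 andbT (lt_trans l0).
have [|eta et eE] := @cw_dist_surj _ _ h _ theta (angle_inf theta).
  by rewrite l0 (lt_trans ls).
have reg : region h theta xi eta =
    [set x | angle_inf theta < angle h theta x < angle_sup theta].
  by rewrite regionE // xE eE (min_idPr (ltW ls)) (max_idPl (ltW ls)).
exists xi, eta; split => //; apply: xget_unique.
  split => /=.
  - by rewrite /clockwise eE xE l0.
  - by apply/domain_sub_region => //; rewrite xE eE (min_idPr (ltW ls)) (max_idPl (ltW ls)).
  - move=> xi' eta' xt' et' /(domain_sub_region xt' et')[a b] sub.
    apply/seteqP; split => // x; rewrite reg regionE //= => /andP[c d].
    by rewrite (le_lt_trans a c) (lt_le_trans d b).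
move=> [xi' eta'] [/= /andP[cw0 cw1] sub min].
have et' : eta' <> theta by move=> E; move: cw0; rewrite E cw_distxx ltxx.
have xt' : xi' <> theta.
  by move=> E; move: (lt_trans cw0 cw1); rewrite E cw_distxx ltxx.
have := sub; rewrite domain_sub_region // (min_idPr (ltW cw1)) (max_idPl (ltW cw1)).
move=> [lo hi].
have reg' : region h theta xi' eta' =
    [set x | cw_dist h theta eta' < angle h theta x < cw_dist h theta xi'].
  by rewrite regionE // (min_idPr (ltW cw1)) (max_idPl (ltW cw1)).
have E : region h theta xi eta = region h theta xi' eta'.
  apply: min => //.
    by apply/domain_sub_region => //; rewrite xE eE (min_idPr (ltW ls)) (max_idPl (ltW ls)).
  by rewrite reg reg' => x /andP[a b]; rewrite /= (le_lt_trans lo a) (lt_le_trans b hi).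
(* Equal regions have equal ends: were the second interval larger, a point of [X] whose angle is the
   extremal value of [P] would lie in one region only. *)
congr pair; apply: (@cw_dist_inj _ _ h _ theta).
  rewrite xE; apply/eqP; rewrite eq_le hi andbT leNgt; apply/negP => lt.
  have [x xA] := angle_surj (h_disk := h_disk) xt.
  have : region h theta xi' eta' x.
    by rewrite reg' /= xA xE lt andbT (le_lt_trans lo).
  by rewrite -E reg /= xA xE ltxx andbF.
rewrite eE; apply/eqP; rewrite eq_le lo /= leNgt; apply/negP => lt.
have [x xA] := angle_surj (h_disk := h_disk) et.
have : region h theta xi' eta' x.
  by rewrite reg' /= xA eE lt /= (lt_le_trans ls).
by rewrite -E reg /= xA eE ltxx.
Qed.

(** The coordinate identifying the interval of angles, with its logarithmic cross-ratio (Hilbert)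
    metric, with the real line. *)
Definition log_angle theta x : R :=
  ln ((angle h theta x - angle_inf theta) / (angle_sup theta - angle h theta x)).

Lemma log_angle_lt theta x y : P x -> P y ->
  (log_angle theta x < log_angle theta y) = (angle h theta x < angle h theta y).
Proof.
move=> Px Py; have /andP[x1 x2] := angle_domain_itv theta Px.
have /andP[y1 y2] := angle_domain_itv theta Py.
rewrite /log_angle ltr_ln ?posrE ?divr_gt0 ?subr_gt0 //.
rewrite ltr_pdivrMr ?subr_gt0 // mulrAC ltr_pdivlMr ?subr_gt0 //.
by apply/idP/idP => ?; nra.
Qed.

Lemma log_angle_le theta x y : P x -> P y ->
  (log_angle theta x <= log_angle theta y) = (angle h theta x <= angle h theta y).
Proof. by move=> Px Py; rewrite leNgt log_angle_lt // -leNgt. Qed.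

Lemma log_angle_eq theta x y : P x -> P y ->
  (log_angle theta x == log_angle theta y) = (angle h theta x == angle h theta y).
Proof. by move=> Px Py; rewrite !eq_le !log_angle_le. Qed.

Lemma dist_thetaE theta x y : P x -> P y ->
  dist_theta h P theta x y = `|log_angle theta x - log_angle theta y|.
Proof.
have [xi [eta [xt et sE xE eE]]] := support_endsE theta.
have log_ratio a b : P a -> P b -> angle h theta b <= angle h theta a ->
    ln (arc_length h theta eta (opposite_end a theta) *
        arc_length h theta xi (opposite_end b theta) /
       (arc_length h theta eta (opposite_end b theta) *
        arc_length h theta xi (opposite_end a theta))) =
    `|log_angle theta a - log_angle theta b|.
  move=> Pa Pb ba; have /andP[a1 a2] := angle_domain_itv theta Pa.
  have /andP[b1 b2] := angle_domain_itv theta Pb.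
  have [at_ bt] := (@opposite_end_neq _ _ X_G1 X_G3 a theta,
                    @opposite_end_neq _ _ X_G1 X_G3 b theta).
  rewrite [RHS]ger0_norm ?subr_ge0 ?log_angle_le //.
  rewrite !arc_lengthE // xE eE -!/(angle h theta _).
  rewrite (distrC (angle_inf theta)) (distrC (angle_inf theta)).
  rewrite !gtr0_norm ?subr_gt0 //.
  rewrite /log_angle -ln_div ?posrE ?divr_gt0 ?subr_gt0 //; congr ln.
  by field; rewrite !subr_eq0 !gt_eqF.
move=> Px Py; rewrite /dist_theta sE /=.
(* Measured from [eta], angles are shifted by the infimum, so the test in [dist_theta] compares the
   angles of [x] and [y]. *)
have cwE z : P z -> cw_dist h eta (opposite_end z theta) = angle h theta z - angle_inf theta.
  move=> /(angle_domain_itv theta)/andP[z1 _].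
  by rewrite (cw_dist_sub theta) eE -/(angle h theta z) ltW.
rewrite !cwE // lerD2r; case: leP => xy; first exact: log_ratio.
by rewrite distrC; apply: log_ratio => //; exact: ltW.
Qed.

End support_lines.

Arguments angle_inf {R X} h P theta.
Arguments angle_sup {R X} h P theta.
Arguments log_angle {R X} h P theta x.

(** * Nonnegative series and betweenness on the real line *)

Section nonnegative_series.
Context {R : realType}.
Implicit Types u v : nat -> R.

Lemma series_le_lim u N : (forall i, 0 <= u i) -> cvgn (series u) ->
  series u N <= limn (series u).
Proof.
move=> u0 cu; apply: nondecreasing_cvgn_le => // n m nm.
by apply: (@nondecreasing_series _ _ xpredT).
Qed.

Lemma term_le_lim_series u i : (forall i, 0 <= u i) -> cvgn (series u) ->
  u i <= limn (series u).
Proof.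
move=> u0 cu; apply: le_trans (series_le_lim i.+1 u0 cu).
by rewrite /series /= big_nat_recr //= lerDr sumr_ge0.
Qed.

(** Partial sums of the nonnegative series [v - u] stay below its limit. This bounds all remainders
    along a line by a single one. *)
Lemma lim_series_tail_le u v N : (forall i, u i <= v i) ->
  cvgn (series u) -> cvgn (series v) ->
  limn (series u) - series u N <= limn (series v) - series v N.
Proof.
move=> uv cu cv.
have H : series (v - u) N <= limn (series (v - u)).
  apply: series_le_lim; last exact: is_cvg_seriesB.
  by move=> i; rewrite /= subr_ge0.
move: H; rewrite lim_seriesB // (_ : series (v - u) N = series v N - series u N).
  by move=> ?; lra.
by rewrite /series /= -sumrB.
Qed.

End nonnegative_series.

Lemma between_norm (R : realType) (a b c : R) :
  `|a - c| = `|a - b| + `|b - c| -> (a <= b <= c) || (c <= b <= a).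
Proof.
move=> H; apply/orP; have [ac|ca] := leP a c.
  left; rewrite distrC ger0_norm ?subr_ge0 // in H.
  have := ler_norm (a - b); have := ler_norm (b - c).
  rewrite -normrN in H; have := ler_norm (b - a); have := ler_norm (c - b).
  have E1 := distrC a b; have E2 := distrC b c.
  by rewrite opprB in H => *; apply/andP; split; lra.
right; rewrite gtr0_norm ?subr_gt0 // in H.
have := ler_norm (a - b); have := ler_norm (b - c).
have := ler_norm (b - a); have := ler_norm (c - b).
have E1 := distrC a b; have E2 := distrC b c.
by move=> *; apply/andP; split; lra.
Qed.

Lemma norm_between (R : realType) (a b c : R) :
  (a <= b <= c) || (c <= b <= a) -> `|a - c| = `|a - b| + `|b - c|.
Proof.
move=> /orP[/andP[ab bc]|/andP[cb ba]].
  by rewrite !ler0_norm ?subr_le0 // ?(le_trans ab bc) //; ring.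
by rewrite !ger0_norm ?subr_ge0 // ?(le_trans cb ba) //; ring.
Qed.

Lemma not_between_far (R : realType) (a b x y z : R) :
  `|b - y| < `|b - a| / 2 -> `|a - x| < `|b - a| / 2 -> `|a - z| < `|b - a| / 2 ->
  ~ ((x <= y <= z) || (z <= y <= x)).
Proof.
have [ba|ab] := leP b a; [rewrite (ler0_norm (x := b - a)) ?subr_le0 //|
  rewrite (gtr0_norm (x := b - a)) ?subr_gt0 //]; rewrite !ltr_norml;
  by move=> /andP[? ?] /andP[? ?] /andP[? ?] /orP[]/andP[? ?]; lra.
Qed.

Lemma norm_sub_between (R : realType) (a b s t : R) :
  (a <= s <= b) || (b <= s <= a) -> (a <= t <= b) || (b <= t <= a) ->
  `|s - t| <= `|a - b|.
Proof.
move=> hs ht; rewrite ler_norml; have [ab|ba] := leP a b.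
  rewrite ler0_norm ?subr_le0 //.
  by move: hs ht => /orP[]/andP[? ?] /orP[]/andP[? ?]; apply/andP; split; lra.
rewrite gtr0_norm ?subr_gt0 //.
by move: hs ht => /orP[]/andP[? ?] /orP[]/andP[? ?]; apply/andP; split; lra.
Qed.

(** * The metric of a convex domain *)

Section polygon_metric.
Context {R : realType} {X : metricType R}.
Context {h : compactification X -> R * R} {h_disk : visual_disk h}.
Context {P : set X} {P_domain : convex_domain P}.
Implicit Types (c g : R -> X) (x y z : X) (xi eta zeta : boundary X).

(** The lines from the fixed point [x] to [ths i] have a limit line, whose end is the limit
    sought. *)
Lemma boundary_compact (I : Type) (G : set_system I) (GU : UltraFilter G)
    (ths : I -> boundary X) (x : X) :
  exists zeta, ideal (ths i) @[i --> G] --> ideal zeta.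
Proof.
have /choice[cs csP] : forall i, exists c,
    [/\ geodesic_line mdist setT c, c 0 = x & pos_end c (ths i)].
  by move=> i; exact: (line_to X_G1 X_G3).
have csl i : geodesic_line mdist setT (cs i) by have [] := csP i.
have [|c [cl c0 csc]] := @line_limit _ _ X_proper _ _ GU cs x csl.
  under eq_fun do rewrite (let: And3 _ e _ := csP _ in e); exact: cvg_cst.
have [z cp] := pos_end_ex cl; exists z.
by apply: (pos_end_cvg _ cp csc) => i; have [] := csP i.
Qed.

(** Numerator and denominator of the quotient both lie between [e] and [2 * pi]. *)
Lemma log_angle_norm_le zeta x e : 0 < e ->
  e <= angle h zeta x - angle_inf h P zeta ->
  e <= angle_sup h P zeta - angle h zeta x ->
  `|log_angle h P zeta x| <= ln (2 * pi / e).
Proof.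
move=> e0 lo hi; have [l0 s2] := angle_extrema_itv (h := h) (P := P) zeta.
have /andP[a0 a2] := angle_itv (h_disk := h_disk) zeta x.
have p0 := @pi_gt0 R.
have A0 : 0 < angle h zeta x - angle_inf h P zeta by exact: lt_le_trans lo.
have B0 : 0 < angle_sup h P zeta - angle h zeta x by exact: lt_le_trans hi.
have pe : 0 < 2 * pi / e by rewrite divr_gt0 ?mulr_gt0.
have AB : 0 < (angle h zeta x - angle_inf h P zeta) /
              (angle_sup h P zeta - angle h zeta x) by rewrite divr_gt0.
rewrite /log_angle ler_norml -lnV ?posrE // !ler_ln ?posrE ?invr_gt0 //.
apply/andP; split.
  by rewrite invf_div ler_pdivrMr ?mulr_gt0 // mulrAC ler_pdivlMr //; nra.
by rewrite ler_pdivrMr // mulrAC ler_pdivlMr //; nra.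
Qed.

(** Uniformity in [zeta] is what makes the series of [d] converge. If it failed, ideal points with
    values above every [n] would accumulate at some [zeta]. Points [p] and [q] of [P] on both sides
    of [x] as seen from [zeta] stay so nearby, and stand in for the infimum and the supremum. *)
Lemma log_angle_bounded x : P x -> exists M, forall zeta, `|log_angle h P zeta x| <= M.
Proof.
move=> Px; apply: contrapT => /forallNP H.
have /choice[ths thP] : forall n : nat, exists zeta, n%:R < `|log_angle h P zeta x|.
  move=> n; have /existsNP[z /negP] := H n%:R.
  by rewrite -ltNge => zn; exists z.
have [G [GU ooG]] := ultraFilterLemma eventually_filter.
have [zeta thz] := boundary_compact GU ths x.
have [p [q [Pp Pq px xq]]] := angle_not_extremal (h_disk := h_disk) zeta Px.
have cv y : angle h (ths i) y @[i --> G] --> angle h zeta y.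
  by apply: angle_cvg => //; exact: cvg_cst.
have low y z : angle h zeta y < angle h zeta z ->
    G [set i | (angle h zeta z - angle h zeta y) / 2 < angle h (ths i) z - angle h (ths i) y].
  move=> yz; have czy : angle h (ths i) z - angle h (ths i) y @[i --> G] -->
      angle h zeta z - angle h zeta y by exact: (cvgB (cv z) (cv y)).
  by apply: (cvgr_gt _ czy); move: yz; lra.
(* Half of each gap at [zeta] survives along [G] by continuity of the angles. *)
pose e := Num.min ((angle h zeta x - angle h zeta p) / 2)
                  ((angle h zeta q - angle h zeta x) / 2).
have e0 : 0 < e by rewrite lt_min !divr_gt0 ?subr_gt0.
have big : G [set i | ln (2 * pi / e) < i%:R] by apply: ooG; exact: nbhs_infty_gtr.
have [i [/= [lp lq] li]] := filter_ex (filterI (filterI (low _ _ px) (low _ _ xq)) big).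
have := thP i; rewrite ltNge => /negP; apply; apply: le_trans (ltW li).
apply: log_angle_norm_le => //.
- rewrite ge_min; apply/orP; left; apply: (le_trans (ltW lp)).
  rewrite lerD2l lerN2; apply: ge_inf; first exact: (angle_has_inf _).2.
  by exists p.
- rewrite ge_min; apply/orP; right; apply: (le_trans (ltW lq)).
  rewrite lerD2r; apply: sup_upper_bound; first exact: angle_has_sup.
  by exists q.
Qed.

Lemma log_angle_line_mono zeta c r s t : geodesic_line mdist setT c ->
  P (c r) -> P (c t) -> r <= s <= t ->
  (log_angle h P zeta (c r) <= log_angle h P zeta (c s) <= log_angle h P zeta (c t)) ||
  (log_angle h P zeta (c t) <= log_angle h P zeta (c s) <= log_angle h P zeta (c r)).
Proof.
move=> cl Pr Pt /andP[rs st].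
have Ps : P (c s) by apply: (line_convex cl Pr Pt); rewrite rs.
rewrite !log_angle_le //.
have [ce|nce] := pselect (pos_end c zeta \/ neg_end c zeta).
  rewrite (angle_const (h_disk := h_disk) r s cl ce).
  by rewrite (angle_const (h_disk := h_disk) s t cl ce) !lexx.
have [H|H] : (forall s t, s < t -> angle h zeta (c s) < angle h zeta (c t)) \/
  (forall s t, s < t -> angle h zeta (c t) < angle h zeta (c s)).
- by apply: angle_line_mono => // ?; apply: nce; [left|right].
- have H' a b : a <= b -> angle h zeta (c a) <= angle h zeta (c b).
    by rewrite le_eqVlt => /predU1P[->//|/H/ltW].
  by apply/orP; left; rewrite (H' _ _ rs) (H' _ _ st).
have H' a b : a <= b -> angle h zeta (c b) <= angle h zeta (c a).
  by rewrite le_eqVlt => /predU1P[->//|/H/ltW].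
by apply/orP; right; rewrite (H' _ _ rs) (H' _ _ st).
Qed.

Context {theta : nat -> boundary X} {w : nat -> R}.
Hypotheses (theta_dense : dense (range theta)) (w_gt0 : forall i, 0 < w i)
  (w_summable : cvgn (series w)).

Local Notation L i x := (log_angle h P (theta i) x).
Local Notation summand x y := (dist_summand h P theta w x y).
Local Notation d := (polygon_dist h P theta w).

Lemma dist_summandE x y i : P x -> P y -> summand x y i = w i * `|L i x - L i y|.
Proof. by move=> Px Py; rewrite /dist_summand dist_thetaE. Qed.

Lemma dist_summand_ge0 x y i : P x -> P y -> 0 <= summand x y i.
Proof. by move=> Px Py; rewrite dist_summandE // mulr_ge0 // ltW. Qed.

Lemma dist_summand_cvg x y : P x -> P y -> cvgn (series (summand x y)).
Proof.
move=> Px Py; have [M HM] := log_angle_bounded Px; have [N HN] := log_angle_bounded Py.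
have M0 : 0 <= M by exact: le_trans (HM (theta 0)).
have N0 : 0 <= N by exact: le_trans (HN (theta 0)).
apply: (@series_le_cvg _ _ ((M + N) *: w)).
- by move=> i; exact: dist_summand_ge0.
- by move=> i; rewrite /= mulr_ge0 ?addr_ge0 // ltW.
- move=> i; rewrite dist_summandE // /= [leRHS]mulrC ler_pM2l //.
  exact: le_trans (ler_normB _ _) (lerD (HM _) (HN _)).
- exact: is_cvg_seriesZ.
Qed.

Lemma polygon_dist_ge_summand x y i : P x -> P y -> summand x y i <= d x y.
Proof.
move=> Px Py; apply: term_le_lim_series; last exact: dist_summand_cvg.
by move=> j; exact: dist_summand_ge0.
Qed.

Lemma polygon_dist_ge0 x y : P x -> P y -> 0 <= d x y.
Proof.
move=> Px Py; apply: le_trans (polygon_dist_ge_summand 0 Px Py).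
exact: dist_summand_ge0.
Qed.

Lemma polygon_distC x y : P x -> P y -> d x y = d y x.
Proof.
move=> Px Py; rewrite /polygon_dist; congr (limn (series _)).
by apply/funext => i; rewrite !dist_summandE // distrC.
Qed.

Lemma polygon_distxx x : P x -> d x x = 0.
Proof.
move=> Px; rewrite /polygon_dist (_ : series _ = fun=> 0) ?lim_cst //.
by apply/funext => n; rewrite /series /= big1 // => i _;
   rewrite dist_summandE // subrr normr0 mulr0.
Qed.

Lemma polygon_dist_triangle x y z : P x -> P y -> P z -> d x z <= d x y + d y z.
Proof.
move=> Px Py Pz; rewrite /polygon_dist -lim_seriesD; try exact: dist_summand_cvg.
apply: lim_series_le; first exact: dist_summand_cvg.
  by apply: is_cvg_seriesD; exact: dist_summand_cvg.
move=> i; rewrite -[leRHS]/(summand x y i + summand y z i) !dist_summandE //.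
rewrite -mulrDr ler_pM2l //.
exact: ler_distD.
Qed.

Lemma polygon_dist_add x y z : P x -> P y -> P z ->
  (forall i, (L i x <= L i y <= L i z) || (L i z <= L i y <= L i x)) ->
  d x z = d x y + d y z.
Proof.
move=> Px Py Pz H; rewrite /polygon_dist -lim_seriesD; try exact: dist_summand_cvg.
congr (limn (series _)); apply/funext => i.
rewrite -[RHS]/(summand x y i + summand y z i) !dist_summandE //.
by rewrite -mulrDr (norm_between (H i)).
Qed.

(** Each summand has a nonnegative defect in its triangle inequality; if the defects sum to zero,
    each vanishes, as the weights are positive. *)
Lemma polygon_dist_add_inv x y z i : P x -> P y -> P z -> d x z = d x y + d y z ->
  (L i x <= L i y <= L i z) || (L i z <= L i y <= L i x).
Proof.
move=> Px Py Pz E; apply: between_norm; apply/eqP; rewrite eq_le; apply/andP; split.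
  exact: ler_distD.
rewrite -(ler_pM2l (w_gt0 i)) mulrDr -!dist_summandE // -subr_le0.
have cD : cvgn (series (summand x y + summand y z)).
  by apply: is_cvg_seriesD; exact: dist_summand_cvg.
have <- : limn (series (summand x y + summand y z - summand x z)) = 0.
  rewrite lim_seriesB //; last exact: dist_summand_cvg.
  rewrite lim_seriesD; [|exact: dist_summand_cvg..].
  by apply/eqP; rewrite subr_eq0; apply/eqP/esym.
apply: (term_le_lim_series (u := summand x y + summand y z - summand x z)).
  move=> j; rewrite -[leRHS]/(summand x y j + summand y z j - summand x z j).
  rewrite !dist_summandE // subr_ge0 -mulrDr ler_pM2l //.
  exact: ler_distD.
by apply: is_cvg_seriesB => //; exact: dist_summand_cvg.
Qed.

Lemma polygon_dist_line c r s t : geodesic_line mdist setT c ->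
  P (c r) -> P (c t) -> r <= s <= t ->
  d (c r) (c t) = d (c r) (c s) + d (c s) (c t).
Proof.
move=> cl Pr Pt rst; apply: polygon_dist_add => //.
  exact: (line_convex cl Pr Pt).
by move=> i; exact: log_angle_line_mono.
Qed.

(** From an ideal point [z] that is not an end of the line [xy], the two angles differ. This is an
    open condition on [z], so some [theta i] satisfies it. *)
Lemma dense_separates x y : x <> y ->
  exists i, angle h (theta i) x <> angle h (theta i) y.
Proof.
move=> xy; have [c [cl c0 cy]] := line_through X_G1 X_G3 x y (theta 0).
have [xi cp] := pos_end_ex cl; have [eta cn] := neg_end_ex cl.
have ex : eta <> xi by move=> E; exact: (line_ends_neq cl cp cn).
have /andP[a0 a2] := cw_dist_itv (h_disk := h_disk) ex.
have [|z zx zE] := @cw_dist_surj _ _ h _ xi (cw_dist h xi eta / 2); first lra.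
have ze : z <> eta by move=> E; move: zE; rewrite E; lra.
have ne : angle h z x - angle h z y != 0.
  rewrite subr_eq0; apply/eqP; rewrite -c0 -cy c0 => E.
  have : 0 = mdist x y.
    apply: (angle_inj (h_disk := h_disk) (theta := z) cl); last by rewrite c0.
      by move=> cz; apply: zx; exact: boundary_eq cz cp.
    by move=> cz; apply: ze; exact: boundary_eq cz cn.
  by move=> /esym/mdist_positivity.
have cts : {for z, continuous (fun th => angle h th x - angle h th y)}.
  exact: (cvgB (@angle_continuous_end _ _ h _ x z) (@angle_continuous_end _ _ h _ y z)).
have : nbhs z [set th | angle h th x - angle h th y != 0].
  by have := @cvgr_neq0 _ _ _ _ _ _ _ cts ne; exact.
rewrite nbhsE => -[U [oU Uz] UH].
have [th [/UH/= H [i _ iE]]] := theta_dense (ex_intro _ z Uz) oU.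
by exists i => E; move: H; rewrite -iE E subrr eqxx.
Qed.

Lemma polygon_dist_eq0 x y : P x -> P y -> d x y = 0 -> x = y.
Proof.
move=> Px Py dxy; apply: contrapT => /dense_separates[i]; apply.
apply/eqP; rewrite -(log_angle_eq (h_disk := h_disk) (P_domain := P_domain)) //.
have := polygon_dist_ge_summand i Px Py; rewrite dxy dist_summandE //.
rewrite pmulr_rle0 // => H; rewrite -subr_eq0 -normr_eq0 eq_le H /=.
exact: normr_ge0.
Qed.

Lemma polygon_dist_metric : metric_on d P.
Proof.
split; [exact: polygon_dist_ge0| |exact: polygon_distC|exact: polygon_dist_triangle].
by move=> x y Px Py; split=> [|->]; [exact: polygon_dist_eq0|exact: polygon_distxx].
Qed.

(* If y lies off the line xz, then near an end of this line the angles of x and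
   z are close to each other but far from the angle of y. *)
Lemma polygon_dist_between x y z c : P x -> P y -> P z ->
  geodesic_line mdist setT c -> c 0 = x -> c (mdist x z) = z -> x <> z ->
  d x z = d x y + d y z -> exists2 t, 0 <= t <= mdist x z & y = c t.
Proof.
move=> Px Py Pz cl c0 cz xz E.
have btw i : (angle h (theta i) x <= angle h (theta i) y <= angle h (theta i) z) ||
             (angle h (theta i) z <= angle h (theta i) y <= angle h (theta i) x).
  by have := polygon_dist_add_inv i Px Py Pz E; rewrite !log_angle_le.
have [t ty] : exists t, c t = y.
  apply: contrapT => ny.
  have [xi cp] := pos_end_ex cl; have [eta cn] := neg_end_ex cl.
  have axE : angle h xi x = cw_dist h xi eta.
    by apply: (angleE cl) => //; exists 0.
  have azE : angle h xi z = cw_dist h xi eta.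
    by apply: (angleE cl) => //; exists (mdist x z).
  have ayE : angle h xi y != cw_dist h xi eta.
    apply/eqP => /angle_opposite_end/(opposite_end_range X_G1 X_G2 X_G3 cl cp cn).
    by move=> [t _ ct]; apply: ny; exists t.
  have cts u : {for xi, continuous (fun th => angle h th u)}.
    exact: angle_continuous_end.
  pose e := `|angle h xi y - cw_dist h xi eta| / 2.
  have e0 : 0 < e by rewrite divr_gt0 // normr_gt0 subr_eq0.
  have nb u : nbhs xi [set th | `|angle h xi u - angle h th u| < e].
    by have /cvgrPdist_lt/(_ _ e0) := cts u.
  pose N u := [set th | `|angle h xi u - angle h th u| < e].
  have : nbhs xi (N y `&` (N x `&` N z)).
    by apply: filterI; [exact: nb|apply: filterI; exact: nb].
  rewrite nbhsE => -[U [oU Uz] UH].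
  have [th [/UH/= [ny' [nx nz]] [i _ iE]]] := theta_dense (ex_intro _ xi Uz) oU.
  move: ny' nx nz (btw i); rewrite /N /= -iE axE azE /e => h1 h2 h3 h4.
  exact: not_between_far h1 h2 h3 h4.
(* It remains to place [t]. A point [theta i] separating [x] from [z] is no end of [c], so its angle
   is strictly monotone along [c] and the order of angles is that of parameters. *)
exists t => //; have [i sep] := dense_separates xz.
have nce : ~ (pos_end c (theta i) \/ neg_end c (theta i)).
  move=> ce; apply: sep; rewrite -c0 -cz.
  exact: (angle_const (h_disk := h_disk) _ _ cl ce).
have d0 := mdist_ge0 x z; clear xz.
have [H|H] : (forall s t, s < t -> angle h (theta i) (c s) < angle h (theta i) (c t)) \/
  (forall s t, s < t -> angle h (theta i) (c t) < angle h (theta i) (c s)).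
- by apply: angle_line_mono => // ?; apply: nce; [left|right].
- have xz : angle h (theta i) x <= angle h (theta i) z.
    by rewrite -c0 -cz; move: d0; rewrite le_eqVlt => /predU1P[<-//|/H/ltW]; rewrite c0.
  have /andP[xy yz] : angle h (theta i) x <= angle h (theta i) y <= angle h (theta i) z.
    by case/orP: (btw i) => // /andP[zy yx]; rewrite (le_trans xz zy) (le_trans yx xz).
  apply/andP; split; rewrite leNgt; apply/negP => /H.
    by rewrite c0 ty ltNge xy.
  by rewrite cz ty ltNge yz.
- have xz : angle h (theta i) z <= angle h (theta i) x.
    by rewrite -c0 -cz; move: d0; rewrite le_eqVlt => /predU1P[<-//|/H/ltW]; rewrite c0.
  have /andP[zy yx] : angle h (theta i) z <= angle h (theta i) y <= angle h (theta i) x.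
    by case/orP: (btw i) => // /andP[xy yz]; rewrite (le_trans xz xy) (le_trans yz xz).
  apply/andP; split; rewrite leNgt; apply/negP => /H.
    by rewrite c0 ty ltNge yx.
  by rewrite cz ty ltNge zy.
Qed.

End polygon_metric.

(** * Geodesics of a convex polygon *)

Section polygon_geodesics.
Context {R : realType} {X : metricType R}.
Context {h : compactification X -> R * R} {h_disk : visual_disk h}.
Context {P : set X} {P_domain : convex_domain P}.
Context {theta : nat -> boundary X} {w : nat -> R} {sides : seq (X * X)}.
Hypotheses (theta_dense : dense (range theta)) (w_gt0 : forall i, 0 < w i)
  (w_summable : cvgn (series w))
  (sides_neq : forall s, s \in sides -> s.1 <> s.2)
  (sides_boundary : closure P `\` interior P =
    \bigcup_(s in [set s | s \in sides]) segment s.1 s.2)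
  (theta_sides : contains_side_ends (range theta) sides).
Implicit Types (c g : R -> X) (x y z : X) (xi eta zeta : boundary X).

Local Notation L i x := (log_angle h P (theta i) x).
Local Notation summand x y := (dist_summand h P theta w x y).
Local Notation d := (polygon_dist h P theta w).

(* The line from a point p of P near c 0 through q := c l passes near c u, so
   that q lies on a segment with ends in P. *)
Lemma domain_accessible c l u : geodesic_line mdist setT c ->
  closure P (c 0) -> P (c u) -> 0 < l < u -> P (c l).
Proof.
move=> cl clP Pu /andP[l0 lu]; set q := c l.
have wP : ProperFilter (within P (nbhs (c 0))) by exact: within_nbhs_proper.
(* The index is itself a point [p] of [P] tending to [c 0]. *)
have [G [GU wG]] := ultraFilterLemma wP.
have GP : G P by apply: wG; exact: withinT.
have Gp : id @ G --> c 0 by move=> A Ap; apply: wG; rewrite /within /=; apply: filterS Ap.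
have /choice[cs csP] : forall p, exists c',
    [/\ geodesic_line mdist setT c', c' 0 = p & c' (mdist p q) = q].
  by move=> p; exact: (line_through X_G1 X_G3 _ _ (theta 0)).
have csl p : geodesic_line mdist setT (cs p) by have [] := csP p.
have cs0 p : cs p 0 = p by have [] := csP p.
have csq p : cs p (mdist p q) = q by have [] := csP p.
have [|c' [c'l c'0 csc]] := @line_limit _ _ X_proper _ _ GU cs (c 0) csl.
  by under eq_fun do rewrite cs0.
have dq : mdist p q @[p --> G] --> l.
  have -> : l = mdist (c 0) q.
    by have /lineP -> := cl; rewrite sub0r normrN gtr0_norm.
  by apply: mdist_cvg => //; exact: cvg_cst.
have c'q : c' l = q.
  have A : cs p (mdist p q) @[p --> G] --> c' l by exact: line_limit_eval.
  have B : cs p (mdist p q) @[p --> G] --> q.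
    by under eq_fun do rewrite csq; exact: cvg_cst.
  by apply: (cvg_unique _ A B); exact: metric_hausdorff.
have E : c' = c by exact: (line_uniq0 X_G1 c'l cl l0).
have Gu : G [set p | P (cs p u)].
  have := csc u; rewrite E => /(_ P (open_nbhs_nbhs (conj domain_open Pu))).
  by [].
have Gq : G [set p | mdist p q < u] by exact: (cvgr_lt _ dq).
have [p [[/= Pp Pcu] pu]] := filter_ex (filterI (filterI GP Gu) Gq).
rewrite -(csq p); apply: (@line_convex _ _ P _ (cs p) 0 _ u (csl p)) => //.
  by rewrite cs0.
by rewrite mdist_ge0 ltW.
Qed.

Lemma side_boundary s x : s \in sides -> segment s.1 s.2 x -> closure P x /\ ~ P x.
Proof.
move=> ss sx; have [] : (closure P `\` interior P) x by rewrite sides_boundary; exists s.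
by rewrite (interior_id P).1 //; exact: domain_open.
Qed.

(** The side itself lies in the boundary, outside [P]. If the line met [P] beyond one end of the
    side, accessibility from the other end would put the nearer end in [P]. *)
Lemma side_line_disjoint s c t : s \in sides -> geodesic_line mdist setT c ->
  c 0 = s.1 -> c (mdist s.1 s.2) = s.2 -> ~ P (c t).
Proof.
move=> ss cl c0 c1 Pt; set l := mdist s.1 s.2 in c1.
have l0 : 0 < l by rewrite mdist_gt0; apply/eqP/sides_neq.
have seg u : 0 <= u <= l -> closure P (c u) /\ ~ P (c u).
  move=> ul; apply: (side_boundary ss); rewrite -c0 -c1; exact: segment_line.
have [cl0 nP0] := seg 0 ltac:(lra); have [cll nPl] := seg l ltac:(lra).
have [tl|lt] := leP t l; last first.
  by apply: nPl; apply: (domain_accessible cl cl0 Pt); rewrite l0.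
have [t0|t0] := leP 0 t; first by have [_] := seg t ltac:(lra).
have := @domain_accessible (fun v => c (- v + l)) l (l - t) (line_rev_shift l cl).
rewrite oppr0 add0r addNr (_ : - (l - t) + l = t); last by ring.
move=> H; apply: nP0; apply: H => //.
by rewrite l0 ltrDl oppr_gt0.
Qed.

Lemma log_angle_cvg zeta c t : geodesic_line mdist setT c -> P (c t) ->
  log_angle h P zeta (c s) @[s --> t] --> log_angle h P zeta (c t).
Proof.
move=> cl Pt.
have /andP[lo hi] := angle_domain_itv (h_disk := h_disk) (P_domain := P_domain) zeta Pt.
have ca : angle h zeta (c s) @[s --> t] --> angle h zeta (c t).
  exact: angle_line_continuous.
have c1 : angle h zeta (c s) - angle_inf h P zeta @[s --> t] -->
    angle h zeta (c t) - angle_inf h P zeta.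
  by apply: cvgB => //; exact: cvg_cst.
have c2 : angle_sup h P zeta - angle h zeta (c s) @[s --> t] -->
    angle_sup h P zeta - angle h zeta (c t).
  by apply: cvgB => //; exact: cvg_cst.
have c3 : (angle_sup h P zeta - angle h zeta (c s))^-1 @[s --> t] -->
    (angle_sup h P zeta - angle h zeta (c t))^-1.
  by apply: cvgV => //; rewrite subr_eq0 gt_eqF.
have c4 : (angle h zeta (c s) - angle_inf h P zeta) /
    (angle_sup h P zeta - angle h zeta (c s)) @[s --> t] -->
    (angle h zeta (c t) - angle_inf h P zeta) /
    (angle_sup h P zeta - angle h zeta (c t)) by exact: (cvgM c1 c3).
apply: (continuous_cvg _ _ c4); apply: continuous_ln.
by rewrite divr_gt0 ?subr_gt0.
Qed.

(** The threshold is the angle at which [log_angle] takes the value [K], obtained by inverting its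
    formula. *)
Lemma log_angle_ge zeta x K : P x ->
  (angle_inf h P zeta + angle_sup h P zeta * expR K) / (1 + expR K) <= angle h zeta x ->
  K <= log_angle h P zeta x.
Proof.
move=> Px; have /andP[lo hi] := angle_domain_itv (h_disk := h_disk) (P_domain := P_domain) zeta Px.
have e0 := expR_gt0 K; rewrite ler_pdivrMr; last lra.
move=> H; rewrite /log_angle -ler_expR lnK; last by rewrite posrE divr_gt0 ?subr_gt0.
by rewrite ler_pdivlMr ?subr_gt0 //; lra.
Qed.

Lemma log_angle_le_bound zeta x K : P x ->
  angle h zeta x <= (angle_inf h P zeta + angle_sup h P zeta * expR K) / (1 + expR K) ->
  log_angle h P zeta x <= K.
Proof.
move=> Px; have /andP[lo hi] := angle_domain_itv (h_disk := h_disk) (P_domain := P_domain) zeta Px.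
have e0 := expR_gt0 K; rewrite ler_pdivlMr; last lra.
move=> H; rewrite /log_angle -ler_expR lnK; last by rewrite posrE divr_gt0 ?subr_gt0.
by rewrite ler_pdivrMr ?subr_gt0 //; lra.
Qed.

(* The point where c leaves P lies on a side; at an end of the line carrying
   that side its angle is extremal, so that log_angle blows up along c. *)
Lemma polygon_dist_unbounded c t0 v : geodesic_line mdist setT c -> P (c t0) ->
  exists t, [/\ t0 <= t, P (c t) & v <= d (c t0) (c t)].
Proof.
move=> cl Pt0; pose T := [set t | P (c t)].
have supT : has_sup T.
  split; first by exists t0.
  have [x0 [r Pr]] := domain_bounded (P := P).
  exists (t0 + (r + r)) => t /Pr Ht; have := Pr _ Pt0 => Ht0.
  have := metric_triangle (c t) x0 (c t0); rewrite (metric_sym (c t) x0).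
  by have /lineP -> := cl; have := ler_norm (t - t0); lra.
pose t1 := sup T.
have t0t1 : t0 < t1.
  have [e e0 He] := line_near cl Pt0.
  apply: (@lt_le_trans _ _ (t0 + e / 2)); first lra.
  apply: (sup_upper_bound supT); apply: He.
  by rewrite opprD addrA subrr sub0r normrN ger0_norm; lra.
have nP1 : ~ P (c t1).
  move=> P1; have [e e0 He] := line_near cl P1.
  have : t1 + e / 2 <= t1.
    apply: (sup_upper_bound supT); apply: He.
    by rewrite opprD addrA subrr sub0r normrN ger0_norm; lra.
  by rewrite gerDl leNgt divr_gt0.
have near1 e : 0 < e -> exists t, [/\ t0 <= t, P (c t) & `|t1 - t| < e].
  move=> e0; pose e' := Num.min e (t1 - t0).
  have e'0 : 0 < e' by rewrite lt_min e0 subr_gt0.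
  have [t Tt te] := sup_adherent e'0 supT.
  have tt1 : t <= t1 by exact: (sup_upper_bound supT).
  have [e1 e2] : e' <= e /\ e' <= t1 - t0 by rewrite /e' !ge_min !lexx orbT.
  exists t; split => //; first by move: te; rewrite -/t1; lra.
  by rewrite ger0_norm ?subr_ge0 //; move: te; rewrite -/t1; lra.
have clP1 : closure P (c t1).
  move=> U /(line_continuous cl (x := t1))/nbhs_ballP[e /= e0 He].
  have [t [_ Pt te]] := near1 e e0.
  by exists (c t); split => //; exact: He.
have [s ss sseg] : (\bigcup_(s in [set s | s \in sides]) segment s.1 s.2) (c t1).
  rewrite -sides_boundary; split => //.
  by rewrite (interior_id P).1 //; exact: domain_open.
have [c' [c'l c'0 c'1]] := line_through X_G1 X_G3 s.1 s.2 (theta 0).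
have seg' : segment s.1 s.2 `<=` range c'.
  have := segment_sub_line X_G1 c'l (mdist_ge0 s.1 s.2).
  by rewrite c'0 c'1 => H z /H[t _ <-]; exists t.
have [xi c'p] := pos_end_ex c'l; have [eta c'n] := neg_end_ex c'l.
have [i _ iE] := theta_sides ss c'l seg' (or_introl c'p).
have bE : angle h xi (c t1) = cw_dist h xi eta.
  by apply: (angleE c'l) => //; exact: seg'.
have nA y : P y -> angle h xi y <> cw_dist h xi eta.
  move=> Py /angle_opposite_end/(opposite_end_range X_G1 X_G2 X_G3 c'l c'p c'n).
  by move=> [t _ ty]; apply: (side_line_disjoint (t := t) ss c'l c'0 c'1); rewrite ty.
have cts : angle h xi (c t) @[t --> t1] --> cw_dist h xi eta.
  by rewrite -bE; exact: angle_line_continuous.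
have lo : angle_inf h P xi <= cw_dist h xi eta.
  rewrite leNgt; apply/negP => lt.
  have /nbhs_ballP[e /= e0 He] : \forall t \near t1,
      angle h xi (c t) < angle_inf h P xi by exact: (cvgr_lt _ cts).
  have [t [_ Pt /He]] := near1 e e0.
  have /andP[a _] := angle_domain_itv (h_disk := h_disk) (P_domain := P_domain) xi Pt.
  by rewrite /= ltNge (ltW a).
have hi : cw_dist h xi eta <= angle_sup h P xi.
  rewrite leNgt; apply/negP => lt.
  have /nbhs_ballP[e /= e0 He] : \forall t \near t1,
      angle_sup h P xi < angle h xi (c t) by exact: (cvgr_gt _ cts).
  have [t [_ Pt /He]] := near1 e e0.
  have /andP[_ a] := angle_domain_itv (h_disk := h_disk) (P_domain := P_domain) xi Pt.
  by rewrite /= ltNge (ltW a).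
have ls : angle_inf h P xi < angle_sup h P xi by exact: angle_inf_lt_sup.
(* A value strictly between would be the angle of a point of [P]; this point would lie on the line
   carrying the side, which misses [P]. *)
have ext : cw_dist h xi eta = angle_inf h P xi \/ cw_dist h xi eta = angle_sup h P xi.
  have [->|/eqP lo'] := eqVneq (cw_dist h xi eta) (angle_inf h P xi); first by left.
  have [->|/eqP hi'] := eqVneq (cw_dist h xi eta) (angle_sup h P xi); first by right.
  have [|y Py yE] := @angle_domain_surj _ _ h _ P _ xi (cw_dist h xi eta).
    by rewrite !lt_neqAle lo hi eq_sym !andbT; apply/andP; split; apply/eqP.
  by case: (nA y Py).
(* One summand suffices: [xi] is an end of a side line, hence some [theta i] with positive
   weight. *)
suff [t [t0t Pt tv]] : exists t, [/\ t0 <= t, P (c t) &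
    v / w i <= `|log_angle h P xi (c t0) - log_angle h P xi (c t)|].
  exists t; split => //; apply: le_trans (polygon_dist_ge_summand _ _ i _ _) => //.
  by rewrite dist_summandE // iE mulrC -ler_pdivrMr.
pose A := log_angle h P xi (c t0); pose V := `|v / w i|.
have V1 : v / w i <= V by exact: ler_norm.
pose m K := (angle_inf h P xi + angle_sup h P xi * expR K) / (1 + expR K).
have mid K : angle_inf h P xi < m K < angle_sup h P xi.
  rewrite /m; have e0 := expR_gt0 K; rewrite ltr_pdivlMr ?ltr_pdivrMr; [|lra..].
  by apply/andP; split; nra.
case: ext => ext.
  have /andP[m1 m2] := mid (A - V); rewrite -ext in m1.
  have /nbhs_ballP[e /= e0 He] : \forall t \near t1, angle h xi (c t) < m (A - V).
    by exact: (cvgr_lt _ cts _ m1).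
  have [t [t0t Pt te]] := near1 e e0; exists t; split => //.
  have := log_angle_le_bound Pt (ltW (He _ te)); rewrite -/A => H.
  by apply: le_trans (ler_norm _); lra.
have /andP[m1 m2] := mid (A + V); rewrite -ext in m2.
have /nbhs_ballP[e /= e0 He] : \forall t \near t1, m (A + V) < angle h xi (c t).
  by exact: (cvgr_gt _ cts _ m2).
have [t [t0t Pt te]] := near1 e e0; exists t; split => //.
have := log_angle_ge Pt (ltW (He _ te)); rewrite -/A => H.
by rewrite distrC; apply: le_trans (ler_norm _); lra.
Qed.

(** The first [N] summands are continuous along [c]. For [s] and [t] in [[a, b]], monotonicity of
    [log_angle] along [c] bounds each summand by the one for [c a] and [c b], so the remainder is
    small uniformly in [s]. *)
Lemma polygon_dist_line_cvg c a b t : geodesic_line mdist setT c ->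
  P (c a) -> P (c b) -> a <= t <= b ->
  forall e, 0 < e -> \forall s \near t, a <= s <= b -> d (c s) (c t) < e.
Proof.
move=> cl Pa Pb atb e e0; have Pt : P (c t) by exact: (line_convex cl Pa Pb).
have cab : cvgn (series (summand (c a) (c b))) by exact: dist_summand_cvg.
have e2 : 0 < e / 2 by lra.
have [N _ /(_ N (leqnn N)) /= HN] : \forall n \near \oo,
    `|limn (series (summand (c a) (c b))) - series (summand (c a) (c b)) n| < e / 2.
  by have /cvgrPdist_lt := cab; exact.
have part : \sum_(0 <= i < N) w i * `|L i (c s) - L i (c t)| @[s --> t] --> (0 : R).
  elim: N {HN} => [|N IH].
    by under eq_fun do rewrite big_nil; exact: cvg_cst.
  have c1 : L N (c s) - L N (c t) @[s --> t] --> (0 : R).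
    have : L N (c s) - L N (c t) @[s --> t] --> L N (c t) - L N (c t).
      by apply: cvgB; [exact: log_angle_cvg|exact: cvg_cst].
    by rewrite subrr.
  have c2 : `|L N (c s) - L N (c t)| @[s --> t] --> (0 : R).
    have : `|L N (c s) - L N (c t)| @[s --> t] --> `|0 : R| by exact: cvg_norm.
    by rewrite normr0.
  have c3 : w N * `|L N (c s) - L N (c t)| @[s --> t] --> w N * 0.
    by apply: cvgM => //; exact: cvg_cst.
  have : \sum_(0 <= i < N) w i * `|L i (c s) - L i (c t)| +
      w N * `|L N (c s) - L N (c t)| @[s --> t] --> 0 + w N * 0 by exact: (cvgD IH c3).
  rewrite mulr0 addr0; apply: near_eq_cvgW; apply: filterE => s /=.
  by rewrite big_nat_recr.
have near_t : \forall s \near t, \sum_(0 <= i < N) w i * `|L i (c s) - L i (c t)| < e / 2.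
  exact: (cvgr_lt _ part).
apply: filterS near_t => s Hs asb.
have Ps : P (c s) by exact: (line_convex cl Pa Pb).
have cst : cvgn (series (summand (c s) (c t))) by exact: dist_summand_cvg.
have le_ab i : summand (c s) (c t) i <= summand (c a) (c b) i.
  rewrite !dist_summandE // ler_pM2l //.
  by apply: norm_sub_between; exact: log_angle_line_mono.
have := lim_series_tail_le N le_ab cst cab.
rewrite -[limn (series (summand (c s) (c t)))]/(d (c s) (c t)).
have -> : series (summand (c s) (c t)) N = \sum_(0 <= i < N) w i * `|L i (c s) - L i (c t)|.
  by apply: eq_bigr => i _; rewrite dist_summandE.
have := ler_norm (limn (series (summand (c a) (c b))) - series (summand (c a) (c b)) N).
by move: Hs HN => /=; lra.
Qed.

End polygon_geodesics.

(** * Parametrization by [d]-length and the lines of [(P, d)] *)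

Lemma eq_of_two_distances (R : realType) (l u t : R) :
  0 < l -> `|u| = `|t| -> `|u - l| = `|t - l| -> u = t.
Proof.
move=> l0 e1 e2.
have E1 : u ^+ 2 = t ^+ 2 by rewrite -real_normK ?num_real // e1 real_normK ?num_real.
have E2 : (u - l) ^+ 2 = (t - l) ^+ 2.
  by rewrite -real_normK ?num_real // e2 real_normK ?num_real.
apply: (mulfI (lt0r_neq0 l0)).
by move: E1 E2; rewrite !sqrrB; lra.
Qed.

Lemma clamp_lipschitz (R : realType) (a b s t : R) : a <= b ->
  `|Num.max a (Num.min s b) - Num.max a (Num.min t b)| <= `|s - t|.
Proof.
move=> ab; wlog st : s t / s <= t => [H|].
  have [/H//|/ltW/H] := leP s t; by rewrite distrC (distrC t).
have m1 : Num.max a (Num.min s b) <= Num.max a (Num.min t b).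
  by rewrite /Num.max /Num.min; do !case: ifPn; rewrite -?leNgt => *; lra.
rewrite distrC ger0_norm ?subr_ge0 // distrC ger0_norm ?subr_ge0 //.
by rewrite /Num.max /Num.min; do !case: ifPn; rewrite -?leNgt => *; lra.
Qed.

Section geodesic_lines.
Context {R : realType} {X : metricType R}.
Context {h : compactification X -> R * R} {h_disk : visual_disk h}.
Context {P : set X} {P_domain : convex_domain P}.
Context {theta : nat -> boundary X} {w : nat -> R} {sides : seq (X * X)}.
Hypotheses (theta_dense : dense (range theta)) (w_gt0 : forall i, 0 < w i)
  (w_summable : cvgn (series w))
  (sides_neq : forall s, s \in sides -> s.1 <> s.2)
  (sides_boundary : closure P `\` interior P =
    \bigcup_(s in [set s | s \in sides]) segment s.1 s.2)
  (theta_sides : contains_side_ends (range theta) sides).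
Implicit Types (c g : R -> X) (x y z : X).

Local Notation d := (polygon_dist h P theta w).

Lemma polygon_dist_reach c t0 v : geodesic_line mdist setT c -> P (c t0) -> 0 <= v ->
  exists t, [/\ t0 <= t, P (c t) & d (c t0) (c t) = v].
Proof.
move=> cl P0 v0.
have [t1 [t01 P1 vd]] := polygon_dist_unbounded (h_disk := h_disk)
  (P_domain := P_domain) w_gt0 w_summable sides_neq sides_boundary theta_sides v cl P0.
(* Clamping to [[t0, t1]] keeps [c (k s)] in [P], so the distance is continuous on the whole real
   line. *)
pose k s := Num.max t0 (Num.min s t1).
have kI s : t0 <= k s <= t1 by rewrite /k le_max lexx /= ge_max t01 ge_min lexx orbT.
have kE s : t0 <= s <= t1 -> k s = s.
  by move=> /andP[a b]; rewrite /k (min_idPl b) (max_idPr a).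
have Pk s : P (c (k s)) by exact: (line_convex cl P0 P1).
have [||t /itvP tI tv] := @IVT R (fun s => d (c t0) (c (k s))) t0 t1 v t01.
- apply: continuous_subspaceT => t; apply/cvgrPdist_lt => e e0.
  have : \forall s \near k t, t0 <= s <= t1 -> d (c s) (c (k t)) < e.
    exact: (polygon_dist_line_cvg w_gt0 w_summable cl P0 P1).
  move=> /nbhs_ballP[r /= r0 Hr]; apply/nbhs_ballP; exists r => // s ts /=.
  have Hs : d (c (k s)) (c (k t)) < e.
    by apply: Hr => //; apply: le_lt_trans ts; exact: clamp_lipschitz.
  have tri := polygon_dist_triangle (h_disk := h_disk) (P_domain := P_domain)
    (theta := theta) w_gt0 w_summable.
  have := tri _ _ _ P0 (Pk s) (Pk t); have := tri _ _ _ P0 (Pk t) (Pk s).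
  rewrite (polygon_distC (Pk t) (Pk s)); move: Hs.
  move: (d (c (k s)) _) (d (c t0) (c (k s))) (d (c t0) (c (k t))) => p q u pe ? ?.
  by rewrite ltr_norml; apply/andP; split; lra.
- rewrite !kE ?lexx ?t01 // polygon_distxx //.
  by rewrite ge_min v0 le_max vd orbT.
exists t; split; rewrite ?tI // -(kE t) ?tI //.
Qed.

(** [D] is the signed [d]-distance from [c t0]. Additivity along [c] makes it isometric, and
    [polygon_dist_reach], applied to [c] and to its reverse, makes it onto. *)
Lemma polygon_dist_chart c t0 : geodesic_line mdist setT c -> P (c t0) ->
  exists D : R -> R,
    (forall s t, P (c s) -> P (c t) -> d (c s) (c t) = `|D s - D t|) /\
    (forall v, exists2 t, P (c t) & D t = v).
Proof.
move=> cl P0.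
pose D t := if t0 <= t then d (c t0) (c t) else - d (c t0) (c t).
have add := polygon_dist_line (h_disk := h_disk) (P_domain := P_domain)
  (theta := theta) w_gt0 w_summable cl.
have D_sub s t : P (c s) -> P (c t) -> s <= t -> d (c s) (c t) = D t - D s.
  move=> Ps Pt st; rewrite /D; have [t0s|st0] := leP t0 s.
    rewrite (le_trans t0s st) (add _ s _ P0 Pt) ?t0s //; ring.
  have [t0t|tt0] := leP t0 t.
    rewrite (add _ t0 _ Ps Pt) ?t0t ?(ltW st0) // (polygon_distC Ps P0); ring.
  have := add _ t _ Ps P0; rewrite st (ltW tt0) => /(_ isT).
  by rewrite (polygon_distC P0 Ps) (polygon_distC P0 Pt) => ->; ring.
exists D; split.
  move=> s t Ps Pt; have [st|/ltW ts] := leP s t.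
    rewrite distrC -D_sub // ger0_norm //; exact: polygon_dist_ge0.
  rewrite -D_sub // ger0_norm ?(polygon_distC Ps Pt) //; exact: polygon_dist_ge0.
move=> v; have [v0|v0] := leP 0 v.
  have [t [t0t Pt tv]] := polygon_dist_reach cl P0 v0.
  by exists t => //; rewrite /D t0t.
have P0' : P (c (- - t0)) by rewrite opprK.
have v0' : 0 <= - v by lra.
have [t [t0t Pt]] := @polygon_dist_reach (fun u => c (- u)) (- t0) _ (line_rev cl) P0' v0'.
rewrite opprK => tv; exists (- t) => //; rewrite /D; case: ifPn => [t0t'|_].
  have E : - t = t0 by lra.
  by move: tv; rewrite E polygon_distxx //; lra.
by rewrite tv opprK.
Qed.

Lemma polygon_line g a b : geodesic_line mdist setT g -> P (g a) -> P (g b) ->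
  exists c, [/\ geodesic_line d P c, c 0 = g a, c (d (g a) (g b)) = g b &
    range c = range g `&` P].
Proof.
move=> gl Pa Pb; have [D [Dd /choice[f fP]]] : exists D : R -> R,
    (forall s t, P (g s) -> P (g t) -> d (g s) (g t) = `|D s - D t|) /\
    (forall v, exists t, P (g t) /\ D t = v).
  have [D [Dd Df]] := polygon_dist_chart gl Pa; exists D; split => // v.
  by have [t Pt tv] := Df v; exists t.
have fK t v : P (g t) -> D t = v -> g (f v) = g t.
  move=> Pt tv; have [Pf fv] := fP v.
  apply: (polygon_dist_eq0 (h_disk := h_disk) theta_dense w_gt0 w_summable) => //.
  by rewrite Dd // fv tv subrr normr0.
(* The orientation that puts [g b] at a nonnegative parameter. *)
pose e : R := if D a <= D b then 1 else -1.
have ee : e * e = 1 by rewrite /e; case: ifP => _; ring.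
have e1 : `|e| = 1 by rewrite /e; case: ifP => _; rewrite ?normrN normr1.
exists (fun v => g (f (D a + e * v))); split.
- split => [v _|s t _ _]; first by have [] := fP (D a + e * v).
  have [Ps sv] := fP (D a + e * s); have [Pt tv] := fP (D a + e * t).
  rewrite Dd // sv tv (_ : _ - _ = e * (s - t)); last ring.
  by rewrite normrM e1 mul1r.
- by apply: fK => //; ring.
- apply: fK => //; rewrite Dd // /e; case: leP => ab.
    by rewrite ler0_norm ?subr_le0 //; ring.
  by rewrite gtr0_norm ?subr_gt0 //; ring.
- apply/seteqP; split => [_ [v _ <-]|z [[t _ <-] Pt]].
    by have [Pf _] := fP (D a + e * v); split => //; exists (f (D a + e * v)).
  exists (e * (D t - D a)) => //; apply: fK => //.
  by rewrite mulrA ee mul1r; ring.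
Qed.

Lemma line_range_eq g g' x y : geodesic_line mdist setT g ->
  geodesic_line mdist setT g' -> x <> y -> range g x -> range g y ->
  range g' x -> range g' y -> range g `<=` range g'.
Proof.
move=> gl g'l xy [s _ sx] [t _ ty] [s' _ sx'] [t' _ ty'] _ [u _ <-].
have st' : s' <> t' by move=> E; apply: xy; rewrite -sx' -ty' E.
have [[b ->]|[b ->]] := line_reparam X_G1 g'l gl st' (etrans sx' (esym sx))
    (etrans ty' (esym ty)).
- by exists (u + b).
- by exists (- u + b).
Qed.

Lemma polygon_dist_on_line g x y z : geodesic_line mdist setT g ->
  P x -> P y -> P z -> x <> z -> range g x -> range g z ->
  d x z = d x y + d y z -> range g y.
Proof.
move=> gl Px Py Pz xz gx gz E.
have [c [cl c0 cz]] := line_through X_G1 X_G3 x z (theta 0).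
have [t _ yE] := polygon_dist_between (h_disk := h_disk) theta_dense w_gt0 w_summable
  Px Py Pz cl c0 cz xz E.
apply: (@line_range_eq c g x z) => //; first by exists 0.
  by exists (mdist x z).
by exists t.
Qed.

Lemma polygon_dist_ends_neq c s t (J : set R) : isometric_map d P J c ->
  J s -> J t -> s <> t -> c s <> c t.
Proof.
move=> [cP ci] Is It st E; apply: st; have := ci s t Is It.
rewrite E polygon_distxx; last exact: cP.
by move=> /esym/normr0_eq0/eqP; rewrite subr_eq0 => /eqP.
Qed.

(** On the [d]-line [c'], a point is determined by its distances to the points at parameters 0 and
    [l]. *)
Lemma polygon_line_agree c c' t (l : R) (J : set R) : 0 < l ->
  isometric_map d P J c -> geodesic_line d P c' -> J 0 -> J l -> J t ->
  c' 0 = c 0 -> c' l = c l -> range c' (c t) -> c' t = c t.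
Proof.
move=> l0 [cP ci] [_ c'i] I0 Il It e0 el [u _ ut].
rewrite -[RHS]ut; congr c'; apply/esym/(eq_of_two_distances l0).
  by have := c'i u 0 I I; rewrite ut e0 ci // !subr0.
by have := c'i u l I I; rewrite ut el ci.
Qed.

Lemma polygon_geodesically_complete : geodesically_complete d P.
Proof.
split=> [x y Px Py|l c [l0 ci]].
  have [g [gl g0 gy]] := line_through X_G1 X_G3 x y (theta 0).
  have [c [[cP ci] c0 cy _]] : exists c, [/\ geodesic_line d P c, c 0 = g 0,
      c (d (g 0) (g (mdist x y))) = g (mdist x y) & range c = range g `&` P].
    by apply: polygon_line => //; rewrite ?g0 ?gy.
  rewrite g0 gy in c0 cy; exists (d x y), c; split => //.
  split; first exact: polygon_dist_ge0.
  by split => [t _|s t _ _]; [exact: cP|exact: ci].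
have I0 : `[0, l]%classic 0 by rewrite /= in_itv /= lexx.
have Il : `[0, l]%classic l by rewrite /= in_itv /= lexx l0.
have [cP cd] := ci; have Px := cP _ I0; have Py := cP _ Il.
have [g [gl g0 gy]] := line_through X_G1 X_G3 (c 0) (c l) (theta 0).
have [c' [c'l c'0 c'y c'r]] : exists c', [/\ geodesic_line d P c', c' 0 = g 0,
    c' (d (g 0) (g (mdist (c 0) (c l)))) = g (mdist (c 0) (c l)) &
    range c' = range g `&` P].
  by apply: polygon_line => //; rewrite ?g0 ?gy.
rewrite g0 gy cd // sub0r normrN ger0_norm // in c'0 c'y.
exists c'; split => // t tl.
have It : `[0, l]%classic t by rewrite /= in_itv.
have [l0'|l0'] := eqVneq l 0.
  by have -> : t = 0; [move: tl; rewrite l0' => /le_anti|].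
have lp : 0 < l by rewrite lt_neqAle eq_sym l0'.
apply: (polygon_line_agree lp ci c'l) => //; rewrite c'r; split; last exact: cP.
apply: (@polygon_dist_on_line g (c 0) (c t) (c l)) => //; try exact: cP.
- by apply: (polygon_dist_ends_neq ci) => // E; move: lp; rewrite -E ltxx.
- by exists 0.
- by exists (mdist (c 0) (c l)).
by rewrite !cd //; apply: norm_between; rewrite tl.
Qed.

Lemma polygon_geodesic_lines :
  [set L : set X | exists2 c, geodesic_line d P c & L = range c] =
  [set L : set X | exists c, [/\ geodesic_line (@mdist R X) setT c,
                                 range c `&` P !=set0 & L = range c `&` P]].
Proof.
apply/seteqP; split => A [].
  move=> c ci ->; have [cP cd] := ci.
  have Pc t : P (c t) by exact: cP.
  have [g [gl g0 gy]] := line_through X_G1 X_G3 (c 0) (c 1) (theta 0).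
  have [c' [c'l c'0 c'y c'r]] : exists c', [/\ geodesic_line d P c', c' 0 = g 0,
      c' (d (g 0) (g (mdist (c 0) (c 1)))) = g (mdist (c 0) (c 1)) &
      range c' = range g `&` P].
    by apply: polygon_line => //; rewrite ?g0 ?gy.
  rewrite g0 gy cd // sub0r normrN normr1 in c'0 c'y.
  have neq s t : s <> t -> c s <> c t by exact: (polygon_dist_ends_neq ci).
  have gx : range g (c 0) by exists 0.
  have gz : range g (c 1) by exists (mdist (c 0) (c 1)).
  have c01 : c 0 <> c 1 by apply: neq => /esym/eqP; rewrite oner_eq0.
  have btw r s t : (r <= s <= t) || (t <= s <= r) ->
      d (c r) (c t) = d (c r) (c s) + d (c s) (c t).
    by move=> rst; rewrite !cd //; exact: norm_between.
  have gc t : range g (c t).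
    (* Equality in the triangle inequality only puts the middle point on the line of the outer two.
       When [t] is outside [[0, 1]], the line through [c t] and the farther of [c 0], [c 1] is used;
       it contains both, hence has the points of [g]. *)
    have [t0|t0] := ltP t 0.
      have [g' [g'l g'0 g'1]] := line_through X_G1 X_G3 (c t) (c 1) (theta 0).
      have g'x : range g' (c 0).
        apply: (@polygon_dist_on_line g' (c t) (c 0) (c 1)) => //.
        - by apply: neq => E; move: t0; rewrite E; lra.
        - by exists 0.
        - by exists (mdist (c t) (c 1)).
        - by apply: btw; rewrite (ltW t0) ler01.
      apply: (@line_range_eq g' g (c 0) (c 1)) => //; last by exists 0.
      by exists (mdist (c t) (c 1)).
    have [t1|t1] := leP t 1.
      by apply: (@polygon_dist_on_line g (c 0) (c t) (c 1)) => //; apply: btw; rewrite t0 t1.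
    have [g' [g'l g'0 g'1]] := line_through X_G1 X_G3 (c 0) (c t) (theta 0).
    have g'x : range g' (c 1).
      apply: (@polygon_dist_on_line g' (c 0) (c 1) (c t)) => //.
      - by apply: neq => E; move: t1; rewrite -E; lra.
      - by exists 0.
      - by exists (mdist (c 0) (c t)).
      - by apply: btw; rewrite ler01 (ltW t1).
    apply: (@line_range_eq g' g (c 0) (c 1)) => //; first by exists 0.
    by exists (mdist (c 0) (c t)).
  have -> : c = c'.
    apply/funext => t; apply/esym; apply: (polygon_line_agree ltr01 ci c'l) => //.
    by rewrite c'r; split.
  by exists g; split => //; exists (c 0).
(* One point of [g] in [P] is enough: [polygon_line] with equal points still parametrizes all of
   [range g] inside [P]. *)
move=> g [gl [_ [[t _ <-] Pt]] ->].
by have [c [cl _ _ cr]] := polygon_line gl Pt Pt; exists c.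
Qed.

End geodesic_lines.

Theorem mainTheorem4 (R : realType) (X : metricType R)
    (X_proper : proper_space X)
    (X_geodesic : geodesic_space (@mdist R X) setT)
    (X_plane : homeomorphic_to X [set: R * R])
    (bdX_circle : homeomorphic_to (boundary X) (@unit_circle R))
    (X_disk : homeomorphic_to (compactification X) (@closed_unit_disk R))
    (X_G1 : G1 X) (X_G2 : G2 X) (X_G3 : G3 X)
    (P : set X) (sides : seq (X * X)) (P_polygon : convex_polygon P sides)
    (h : compactification X -> R * R)
    (h_homeo : homeomorphism_onto h (@closed_unit_disk R))
    (h_circle : h @` range (@ideal R X) = @unit_circle R)
    (theta : nat -> boundary X)
    (theta_dense : dense (range theta))
    (theta_sides : contains_side_ends (range theta) sides)
    (w : nat -> R) (w_gt0 : forall i, 0 < w i) (w_summable : cvgn (series w)) :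
  let d := polygon_dist h P theta w in
  [/\ forall x y, P x -> P y -> cvgn (series (dist_summand h P theta w x y)),
      metric_on d P,
      geodesically_complete d P &
      [set L : set X | exists2 c, geodesic_line d P c & L = range c] =
      [set L : set X | exists c, [/\ geodesic_line (@mdist R X) setT c,
                                     range c `&` P !=set0 &
                                     L = range c `&` P]]].
Proof.
have [P0 oP bP cP [sides_neq sides_boundary]] := P_polygon.
have [h_continuous _ [k [hK _]]] := h_homeo.
have h_disk : visual_disk h by split => //; exact: can_inj hK.
have P_domain : convex_domain P by split.
split.
- by move=> x y; exact: dist_summand_cvg.
- exact: polygon_dist_metric.
- exact: (polygon_geodesically_complete theta_dense w_gt0 w_summable
    sides_neq sides_boundary theta_sides).
- exact: (polygon_geodesic_lines theta_dense w_gt0 w_summable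
    sides_neq sides_boundary theta_sides).
Qed.
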